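(* Let $n\ge 2$, $\alpha>-1$ and $Q\in L^\infty_{\rm loc}(\mathbb{R}^n)$. Let $u$ be a radial normal solution of $(-\Delta)^{n/2}u=|x|^{n\alpha}Qe^{nu}$ in $\mathbb{R}^n$ with $\int_{\mathbb{R}^n}|x|^{n\alpha}|Q|e^{nu}\,dx<\infty$, and let $\Lambda:=\int_{\mathbb{R}^n}|x|^{n\alpha}e^{nu(x)}\,dx\in(0,+\infty]$. If $Q\le 1$, then $$\Lambda\ge \Lambda_1(1+\alpha).$$ Moreover, equality holds if and only if $Q\equiv 1$.
   Context: Notation: $\gamma_n:=\frac{(n-1)!}{2}|\mathbb{S}^n|$ and $\Lambda_1:=2\gamma_n=(n-1)!\,|\mathbb{S}^n|$, where $|\mathbb{S}^n|$ is the surface measure of the unit sphere in $\mathbb{R}^{n+1}$. A normal solution of $(-\Delta)^{n/2}u=|x|^{n\alpha}Qe^{nu}$ with $|x|^{n\alpha}Qe^{nu}\in L^1(\mathbb{R}^n)$ is a function $u$ satisfying, for some $c\in\mathbb{R}$, the integral equation $$u(x)=\frac{1}{\gamma_n}\int_{\mathbb{R}^n}\log\left(\frac{1+|y|}{|x-y|}\right)|y|^{n\alpha}Q(y)e^{nu(y)}\,dy+c .$$ For $Q\in L^\infty_{\rm loc}$ and $\alpha>-1$ such $u$ is continuous on $\mathbb{R}^n$ and $C^1$ on $\mathbb{R}^n\setminus\{0\}$. Inequalities and identities for $Q$ are understood almost everywhere. *)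

(* Defs.v *)
From HB Require Import structures.
From mathcomp Require Import all_boot all_order all_algebra.
From mathcomp Require Import all_classical all_reals all_analysis.
From mathcomp Require Import measurable_realfun lra.

Set Implicit Arguments.
Unset Strict Implicit.
Unset Printing Implicit Defensive.

Import Order.TTheory GRing.Theory Num.Theory.
Import numFieldNormedType.Exports.

Local Open Scope classical_set_scope.
Local Open Scope ring_scope.

(* R^n is the type n.-tuple R, with the sigma-algebra generated by the
   coordinates (that is, the Borel sigma-algebra) supplied by the library. *)

Definition tcons (R : realType) (n : nat)
    (p : measurableTypeR R * n.-tuple R) : n.+1.-tuple R :=
  [the n.+1.-tuple R of (p.1 : R) :: p.2].

(* Lebesgue measure on R^n = R * R^(n-1), as an iterated product measure. *)
Fixpoint lebesgue_tuple (R : realType) (n : nat) :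
    set (n.-tuple R) -> \bar R :=
  match n with
  | 0 => dirac [tuple]
  | m.+1 => pushforward (lebesgue_measure \x @lebesgue_tuple R m)%E
                        (@tcons R m)
  end.
Arguments lebesgue_tuple {R} n.

Section lebesgue_tuple_measure.
Context (R : realType).
Local Open Scope ereal_scope.

Lemma measurable_tcons (n : nat) : measurable_fun setT (@tcons R n).
Proof.
apply: (@measurable_cons _ _ (measurableTypeR R * n.-tuple R)%type R
  (fun p => p.1) n (fun p => p.2)).
- exact: (@measurable_fst _ _ (measurableTypeR R)).
- exact: measurable_snd.
Qed.

Lemma measurable_tbox (n : nat) (A : 'I_n -> set R) :
  (forall i, measurable (A i)) ->
  measurable [set x : n.-tuple R | forall i, A i (tnth x i)].
Proof.
move=> mA.
rewrite (_ : [set _ | _] =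
    \bigcap_(i in [set: 'I_n]) ((@tnth n R)^~ i @^-1` (A i))); last first.
  by apply/seteqP; split => x /= h i; [move=> _|]; exact: h.
apply: fin_bigcap_measurable; first exact: finite_finset.
by move=> i _; rewrite -[X in measurable X]setTI; exact: measurable_tnth.
Qed.

Section step.
Context (n : nat) (m : {sigma_finite_measure set (n.-tuple R) -> \bar R}).

Let step := pushforward (lebesgue_measure \x m) (@tcons R n).

Let step0 : step set0 = 0.
Proof. by rewrite /step /pushforward preimage_set0 measure0. Qed.

Let step_ge0 A : 0 <= step A.
Proof. by rewrite /step /pushforward; exact: measure_ge0. Qed.

Let step_sigma_additive : semi_sigma_additive step.
Proof.
have mp A : measurable A -> measurable (@tcons R n @^-1` A).
  by move=> mA; rewrite -[X in measurable X]setTI; exact: measurable_tcons.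
move=> F mF tF mUF; rewrite /step /pushforward preimage_bigcup.
apply: measure_semi_sigma_additive.
- by move=> k; exact: mp.
- apply/trivIsetP => /= i j _ _ ij; rewrite -preimage_setI.
  by move/trivIsetP : tF => /(_ _ _ _ _ ij) ->//; rewrite preimage_set0.
- by rewrite -preimage_bigcup; exact: mp.
Qed.

#[local] HB.instance Definition _ := isMeasure.Build _ _ _ step
  step0 step_ge0 step_sigma_additive.

Lemma tcons_preimage_box (A : 'I_n.+1 -> set R) :
  @tcons R n @^-1` [set x | forall i, A i (tnth x i)] =
  A ord0 `*` [set x | forall i, A (lift ord0 i) (tnth x i)].
Proof.
apply/seteqP; split => -[a s] /=.
  move=> h; split; first exact: (h ord0).
  by move=> i; have := h (lift ord0 i); rewrite tnthS.
move=> [ha hs] i; case: (unliftP ord0 i) => [j ->|-> //].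
by rewrite tnthS; exact: hs.
Qed.

Let step_sigma_finite : sigma_finite setT step.
Proof.
have /sigma_finiteP[F [TF ndF Foo]] := sigma_finiteT (@lebesgue_measure R).
have /sigma_finiteP[G [TG ndG Goo]] := sigma_finiteT m.
exists (fun k => [set x : n.+1.-tuple R |
  F k (thead x) /\ G k [tuple of behead x]]).
  apply/seteqP; split => // x _.
  have [k _ Fk] : (\bigcup_i F i) (thead x) by rewrite -TF.
  have [l _ Gl] : (\bigcup_i G i) [tuple of behead x] by rewrite -TG.
  exists (maxn k l) => //; split.
    by move: Fk; exact/subsetPset/ndF/leq_maxl.
  by move: Gl; exact/subsetPset/ndG/leq_maxr.
move=> k; have [mFk Fkoo] := Foo k; have [mGk Gkoo] := Goo k.
have mh : measurable_fun setT (@thead n R : n.+1.-tuple R -> R).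
  exact: measurable_tnth.
split.
  rewrite (_ : [set _ | _] =
    (@thead n R @^-1` (F k)) `&`
    ((fun x : n.+1.-tuple R => [tuple of behead x]) @^-1` (G k)))//.
  apply: measurableI; rewrite -[X in measurable X]setTI.
    exact: mh.
  exact: measurable_behead.
rewrite /step /pushforward (_ : _ @^-1` _ = F k `*` G k).
  by rewrite product_measure1E// lte_mul_pinfty// ge0_fin_numE.
apply/seteqP; split => -[a s] /=; rewrite theadE.
  by move=> [? h]; split=> //; move: h; congr (G k _); exact: val_inj.
by move=> [? h]; split=> //; move: h; congr (G k _); exact: val_inj.
Qed.

#[local] HB.instance Definition _ := Measure_isSigmaFinite.Build _ _ _ step
  step_sigma_finite.

Definition lebesgue_step :
  {sigma_finite_measure set (n.+1.-tuple R) -> \bar R} := step.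

End step.

Lemma lebesgue_tuple_ex n :
  exists m : {sigma_finite_measure set (n.-tuple R) -> \bar R},
    (m : set _ -> \bar R) = lebesgue_tuple n.
Proof.
elim: n => [|n [m mE]]; first by exists (dirac [tuple]).
by exists (lebesgue_step m); rewrite /= -mE.
Qed.

Let leb0 n : lebesgue_tuple n set0 = 0 :> \bar R.
Proof. by have [m <-] := lebesgue_tuple_ex n; exact: measure0. Qed.

Let leb_ge0 n (A : set (n.-tuple R)) : 0 <= lebesgue_tuple n A.
Proof. by have [m <-] := lebesgue_tuple_ex n; exact: measure_ge0. Qed.

Let leb_sigma_additive n : semi_sigma_additive (@lebesgue_tuple R n).
Proof.
by have [m <-] := lebesgue_tuple_ex n; exact: measure_semi_sigma_additive.
Qed.

HB.instance Definition _ n := isMeasure.Build _ _ _ (@lebesgue_tuple R n)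
  (leb0 n) (@leb_ge0 n) (@leb_sigma_additive n).

Let leb_sigma_finite n : sigma_finite setT (@lebesgue_tuple R n).
Proof. by have [m <-] := lebesgue_tuple_ex n; exact: sigma_finiteT. Qed.

HB.instance Definition _ n := Measure_isSigmaFinite.Build _ _ _
  (@lebesgue_tuple R n) (leb_sigma_finite n).

Lemma lebesgue_tuple_box n (A : 'I_n -> set R) :
  (forall i, measurable (A i)) ->
  lebesgue_tuple n [set x | forall i, A i (tnth x i)] =
  \prod_(i < n) lebesgue_measure (A i).
Proof.
elim: n A => [|n ih] A mA.
  by rewrite big_ord0 /= diracE mem_set// => -[].
rewrite big_ord_recl -ih// /= /pushforward tcons_preimage_box.
rewrite product_measure1E//; first exact: mA.
exact: (@measurable_tbox n (fun i => A (lift ord0 i))).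
Qed.

End lebesgue_tuple_measure.

Section euclidean.
Context (R : realType) (n : nat).
Implicit Types x y : n.-tuple R.

Definition enorm x : R := Num.sqrt (\sum_(i < n) tnth x i ^+ 2).

Definition tsub x y : n.-tuple R := [tuple tnth x i - tnth y i | i < n].

Definition tscale (r : R) x : n.-tuple R := [tuple r * tnth x i | i < n].

Definition radial (u : n.-tuple R -> R) :=
  forall x y, enorm x = enorm y -> u x = u y.

(* Local boundedness is tested on balls, as every compact set is contained in
   one; Q is a Borel representative of its class modulo null sets. *)
Definition Linfty_loc (Q : n.-tuple R -> R) :=
  measurable_fun setT Q /\
  forall r : R, exists M : R,
    {ae @lebesgue_tuple R n, forall x, enorm x <= r -> `|Q x| <= M}.

Definition unit_sphere : set (n.-tuple R) := [set x | enorm x = 1].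

Definition sphere_cone (E : set (n.-tuple R)) : set (n.-tuple R) :=
  [set x | exists r : R, exists2 e, 0 < r <= 1 /\ E e & x = tscale r e].

(* The surface measure of a subset E of the unit sphere of R^n, as it occurs
   in polar coordinates: n times the volume of the cone over E. *)
Definition sphere_measure (E : set (n.-tuple R)) : \bar R :=
  (n%:R%:E * lebesgue_tuple n (sphere_cone E))%E.

Lemma measurable_enorm : measurable_fun setT enorm.
Proof.
apply: (@measurableT_comp _ _ _ _ _ _ (@Num.sqrt R) _
  (fun x : n.-tuple R => \sum_(i < n) tnth x i ^+ 2)).
  by apply: continuous_measurable_fun; exact: sqrt_continuous.
apply: measurable_sum => i; apply: measurable_funX; exact: measurable_tnth.
Qed.

Lemma ler_tnth_enorm x i : `|tnth x i| <= enorm x.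
Proof.
rewrite -sqrtr_sqr ler_wsqrtr// (bigD1 i)//= lerDl.
by apply: sumr_ge0 => j _; exact: sqr_ge0.
Qed.

Lemma enorm_scale (r : R) x : 0 <= r -> enorm (tscale r x) = r * enorm x.
Proof.
move=> r0; rewrite /enorm.
under eq_bigr do rewrite tnth_mktuple exprMn.
by rewrite -mulr_sumr sqrtrM ?sqr_ge0// sqrtr_sqr ger0_norm.
Qed.

Lemma cone_unit_sphere :
  sphere_cone unit_sphere = [set x | 0 < enorm x <= 1].
Proof.
apply/seteqP; split => x /=.
  move=> [r [e [/andP[r0 r1] e1] ->]].
  by rewrite (enorm_scale _ (ltW r0)) e1 mulr1 r0 r1.
move=> /andP[x0 x1]; exists (enorm x), (tscale (enorm x)^-1 x).
  split; first by rewrite x0 x1.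
  by rewrite /unit_sphere/= enorm_scale ?invr_ge0 ?ltW// mulVf ?gt_eqF.
apply: eq_from_tnth => i; rewrite !tnth_mktuple mulrA divff ?mul1r//.
by rewrite gt_eqF.
Qed.

Lemma sphere_measure_unit_sphere_bounds :
  (0 < n)%N -> (0 < sphere_measure unit_sphere < +oo)%E.
Proof.
move=> n0; rewrite /sphere_measure cone_unit_sphere.
set B := [set x | _].
have mB : measurable B.
  rewrite (_ : B = enorm @^-1` `]0, 1]).
    by rewrite -[X in measurable X]setTI; exact: measurable_enorm.
  by apply/seteqP; split => x /=; rewrite in_itv.
have boxE (a b : R) : a <= b ->
    lebesgue_tuple n [set x | forall i, `]a, b]%classic (tnth x i)] =
    ((b - a) ^+ n)%:E.
  move=> ab; rewrite (@lebesgue_tuple_box R n (fun=> `]a, b]%classic))//.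
  rewrite (eq_bigr (fun=> (b - a)%:E)); last first.
    move=> i _; rewrite lebesgue_measure_itv/= lte_fin.
    by case: ltgtP ab => // -> _; rewrite subrr.
  by rewrite prodEFin prodr_const card_ord.
apply/andP; split.
  apply: mule_gt0; first by rewrite lte_fin ltr0n.
  apply: (@lt_le_trans _ _ (lebesgue_tuple n
      [set x | forall i, `]0, n%:R^-1]%classic (tnth x i)])).
    by rewrite boxE ?invr_ge0// subr0 lte_fin exprn_gt0// invr_gt0 ltr0n.
  apply: le_measure; rewrite ?inE//; first exact: (@measurable_tbox R n (fun=> _)).
  move=> x /= xb.
  have xi i : 0 < tnth x i <= n%:R^-1 by have := xb i; rewrite /= in_itv.
  have x0 : 0 < enorm x.
    have /andP[h _] := xi (Ordinal n0).
    apply: lt_le_trans (ler_tnth_enorm _ (Ordinal n0)).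
    by rewrite normr_gt0 gt_eqF.
  rewrite /B /= x0 -[leRHS]sqrtr1 ler_wsqrtr//.
  apply: (@le_trans _ _ (\sum_(i < n) n%:R^-1)); last first.
    by rewrite sumr_const card_ord -[leLHS]mulr_natr mulVf// pnatr_eq0 -lt0n.
  apply: ler_sum => i _; have /andP[h1 h2] := xi i.
  have n1 : n%:R^-1 <= 1 :> R by rewrite invf_le1 ?ltr0n// ler1n.
  by rewrite expr2 -[leRHS]mulr1; apply: ler_pM (ltW h1) (ltW h1) h2 (le_trans h2 n1).
apply: lte_mul_pinfty => //.
apply: (@le_lt_trans _ _ (lebesgue_tuple n
    [set x | forall i, `](-2), 1]%classic (tnth x i)])).
  apply: le_measure; rewrite ?inE//; first exact: (@measurable_tbox R n (fun=> _)).
  move=> x /= /andP[_ x1] i.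
  have := le_trans (ler_tnth_enorm x i) x1.
  by rewrite ler_norml /= in_itv/= => /andP[h ->]; rewrite (lt_le_trans _ h)// ltrN2 ltr1n.
by rewrite boxE ?ltry//; lra.
Qed.

End euclidean.

Section normal_solutions.
Context (R : realType).

Definition sphere_area (n : nat) : R :=
  fine (sphere_measure (@unit_sphere R n.+1)).

Lemma sphere_area_gt0 (n : nat) : 0 < sphere_area n.
Proof.
by apply: fine_gt0; exact: sphere_measure_unit_sphere_bounds.
Qed.

Definition gamma_ (n : nat) : R := (n.-1)`!%:R / 2 * sphere_area n.

Definition Lambda1 (n : nat) : R := 2 * gamma_ n.

Context (n : nat).
Implicit Types (alpha : R) (Q u : n.-tuple R -> R).

(* u is a normal solution of (-Delta)^(n/2) u = |x|^(n alpha) Q e^(n u).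
   The equation is stated in \bar R.  As the left-hand side is finite, and the
   library's integral is -oo as soon as the negative part has infinite
   integral, it forces the integral to converge absolutely for every x. *)
Definition normal_solution alpha Q u :=
  (@lebesgue_tuple R n).-integrable setT
    (fun x => (enorm x `^ (n%:R * alpha) * Q x * expR (n%:R * u x))%:E) /\
  exists c : R, forall x,
    (u x)%:E =
    ((gamma_ n)^-1%:E *
      \int[@lebesgue_tuple R n]_y
        (ln ((1 + enorm y) / enorm (tsub x y)) *
         (enorm y `^ (n%:R * alpha) * Q y * expR (n%:R * u y)))%:E +
     c%:E)%E.

End normal_solutions.

(* Main.v *)
Require Import Defs.
From HB Require Import structures.
From mathcomp Require Import all_boot all_order all_algebra.
From mathcomp Require Import all_classical all_reals all_analysis.
From mathcomp Require Import measurable_realfun ring lra.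

Set Implicit Arguments.
Unset Strict Implicit.
Unset Printing Implicit Defensive.

Import Order.TTheory GRing.Theory Num.Theory.
Import numFieldNormedType.Exports.

Local Open Scope classical_set_scope.
Local Open Scope ring_scope.

(** The proof is a Pohozaev identity in which the derivative along dilations is
    replaced by a finite difference, so that neither the regularity of [u] nor
    the decay of a boundary term enters.

    Let [w = |x|^(n alpha) e^(n u)], so that the curvature measure has density
    [Q w], and write [Lambda] for the mass of [w], assumed finite.  As [u] is
    radial, the integral equation may be averaged over the points of a circle
    of radius [r] in a fixed coordinate plane ([mean_formula]).  The average of
    [ln |x - y|] over [x] in this circle is the logarithm of half the sum of
    the distances from [(r, 0)] to the points [(+- s t, s sqrt (1 - t^2))] of a
    plane, where [s = |y|] and [s t] is the norm of the projection of [y] to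
    the coordinate plane ([focal_mean], [circle_pt_mean]).  Comparing the radii
    [e^(-h) r] and [e^h r] gives ([profile_difference])
      [gamma (u (e^(-h) r) - u (e^h r)) = int K_h (r, |y|, t) Q w dy],
    where the kernel satisfies [0 <= K_h <= 2 h] and
    [K_h (r, s, t) + K_h (s, r, t) = 2 h] ([focal_kernel_ge0],
    [focal_kernel_le], [focal_kernel_sym]).

    Multiply by [w (x)] with [r = |x|] and integrate.  On the left, the bound on
    [K_h] shows that [u] is Lipschitz in [ln |x|] ([profile_lip]), and the
    invariance of the mass of [w] under dilations then shows that the integral
    is [2 gamma (1 + alpha) h Lambda + O(h^2)] ([weight_increment_expansion]).
    On the right, replacing [Q] by [1] can only increase the integral since
    [K_h >= 0], and for [Q = 1] it equals [h Lambda^2]: the angular variable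
    [t] is independent of the radius, so [K_h] may be symmetrized
    ([ge0_integral_radial_sym], [integral_focal_kernel]).  Dividing by [h] and
    letting [h] tend to [0] yields [2 gamma (1 + alpha) Lambda <= Lambda^2],
    with equality when [Q = 1].  Conversely, [K_h >= h] as soon as
    [4 |y| <= |x|] ([focal_kernel_far]), so that in the case of equality
    [1 - Q] integrates to zero against a positive weight. *)

(** * The averaged logarithmic kernel *)

Section focal_mean.
Context (R : realType).
Implicit Types r s t a h : R.

(** Half the sum of the distances from the point [(r, 0)] of a plane to the
    points [(- s t, s sqrt (1 - t^2))] and [(s t, s sqrt (1 - t^2))]. *)
Definition focal_mean r s t : R :=
  (Num.sqrt (r ^+ 2 + s ^+ 2 + 2 * (r * s * t)) +
   Num.sqrt (r ^+ 2 + s ^+ 2 - 2 * (r * s * t))) / 2.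

Lemma focal_meanC r s t : focal_mean r s t = focal_mean s r t.
Proof. by rewrite /focal_mean (addrC (r ^+ 2)) (mulrC r). Qed.

Lemma focal_meanZ a r s t : 0 <= a ->
  focal_mean (a * r) (a * s) t = a * focal_mean r s t.
Proof.
move=> a0; rewrite /focal_mean.
have E (e : R) : (a * r) ^+ 2 + (a * s) ^+ 2 + e * (2 * (a * r * (a * s) * t)) =
    a ^+ 2 * (r ^+ 2 + s ^+ 2 + e * (2 * (r * s * t))) by ring.
have := E 1; have := E (-1); rewrite !mulN1r !mul1r => -> ->.
by rewrite !sqrtrM ?sqr_ge0// -!expr2 sqr_sqrtr// -mulrDr -[LHS]mulrA.
Qed.

Lemma focal_mean0 r t : 0 <= r -> focal_mean r 0 t = r.
Proof.
move=> r0; rewrite /focal_mean !(mulr0, mul0r) subr0 expr0n/= !addr0 sqrtr_sqr.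
by rewrite ger0_norm//; lra.
Qed.

Lemma focal_disc_ge0 r s t : 0 <= r -> 0 <= s -> 0 <= t <= 1 ->
  0 <= r ^+ 2 + s ^+ 2 - 2 * (r * s * t).
Proof.
move=> r0 s0 /andP[t0 t1]; have rs : 0 <= r * s by rewrite mulr_ge0.
have : r * s * t <= r * s by rewrite ler_piMr.
have := sqr_ge0 (r - s); nra.
Qed.

Lemma focal_sum_ge0 r s t : 0 <= r -> 0 <= s -> 0 <= t <= 1 ->
  0 <= r ^+ 2 + s ^+ 2 + 2 * (r * s * t).
Proof.
move=> r0 s0 /andP[t0 t1].
by rewrite !addr_ge0 ?sqr_ge0// !mulr_ge0.
Qed.

Lemma focal_mean_sqr r s t : 0 <= r -> 0 <= s -> 0 <= t <= 1 ->
  2 * focal_mean r s t ^+ 2 = r ^+ 2 + s ^+ 2 +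
    Num.sqrt ((r ^+ 2 + s ^+ 2) ^+ 2 - (2 * (r * s * t)) ^+ 2).
Proof.
move=> r0 s0 t01.
have D0 := focal_disc_ge0 r0 s0 t01; have S0 := focal_sum_ge0 r0 s0 t01.
rewrite subr_sqr sqrtrM// /focal_mean.
set X := Num.sqrt (_ + 2 * _); set Y := Num.sqrt (_ - _).
have := sqr_sqrtr S0; have := sqr_sqrtr D0; rewrite -/X -/Y => hY hX.
have -> : 2 * ((X + Y) / 2) ^+ 2 = (X ^+ 2 + Y ^+ 2) / 2 + X * Y by field.
by rewrite hX hY; lra.
Qed.

Lemma focal_mean_ge0 r s t : 0 <= focal_mean r s t.
Proof. by rewrite divr_ge0// addr_ge0// sqrtr_ge0. Qed.

Lemma focal_mean_ge r s t : 0 <= r -> 0 <= s -> 0 <= t <= 1 ->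
  (r + s) / 2 <= focal_mean r s t.
Proof.
move=> r0 s0 t01.
rewrite -(@ler_pXn2r _ 2)// ?nnegrE ?focal_mean_ge0//; last first.
  by rewrite divr_ge0// addr_ge0.
have := focal_mean_sqr r0 s0 t01.
set f := focal_mean _ _ _; set d := Num.sqrt _ => fE.
have d0 : 0 <= d by exact: sqrtr_ge0.
have := sqr_ge0 (r - s); have -> : ((r + s) / 2) ^+ 2 = (r + s) ^+ 2 / 4 by field.
by lra.
Qed.

Lemma focal_mean_gt0 r s t : 0 < r -> 0 <= s -> 0 <= t <= 1 ->
  0 < focal_mean r s t.
Proof.
move=> r0 s0 t01; apply: lt_le_trans (focal_mean_ge (ltW r0) s0 t01).
by rewrite divr_gt0// ltr_pwDl.
Qed.

(** As a function of [r], [focal_mean] is the mean of two convex functions that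
    [r |-> - r] exchanges, hence it is convex and even.  The proof compares
    squares by means of [focal_mean_sqr]. *)
Lemma focal_mean_homo r1 r2 s t : 0 <= r1 -> r1 <= r2 -> 0 <= s ->
  0 <= t <= 1 -> focal_mean r1 s t <= focal_mean r2 s t.
Proof.
move=> r10 r12 s0 t01; have r20 := le_trans r10 r12.
rewrite -(@ler_pXn2r _ 2)// ?nnegrE ?focal_mean_ge0//.
have := focal_mean_sqr r10 s0 t01; have := focal_mean_sqr r20 s0 t01.
set f1 := focal_mean r1 _ _; set f2 := focal_mean r2 _ _.
set D1 := (r1 ^+ 2 + _) ^+ 2 - _; set D2 := (_ + _) ^+ 2 - _ => f2E f1E.
have D20 : 0 <= D2.
  rewrite /D2 subr_sqr mulr_ge0//; first exact: focal_disc_ge0.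
  exact: focal_sum_ge0.
have d0 : 0 <= r2 ^+ 2 - r1 ^+ 2 by rewrite subr_ge0 ler_pXn2r.
have A0 : 0 <= r2 ^+ 2 + s ^+ 2 by rewrite addr_ge0// sqr_ge0.
have t2 : t ^+ 2 <= 1 by rewrite expr_le1//; case/andP: t01.
set e2 := Num.sqrt D2 in f2E.
have e20 : 0 <= e2 by exact: sqrtr_ge0.
have e2E : e2 ^+ 2 = D2 by exact: sqr_sqrtr.
suff : Num.sqrt D1 <= e2 + (r2 ^+ 2 - r1 ^+ 2) by lra.
rewrite -(ger0_norm (_ : 0 <= e2 + (r2 ^+ 2 - r1 ^+ 2))); last exact: addr_ge0.
rewrite -sqrtr_sqr ler_wsqrtr//.
(* the factor that remains when [r2 ^+ 2 - r1 ^+ 2] is taken out of the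
   difference of the squares of the two sides *)
have key : 0 <= r2 ^+ 2 + s ^+ 2 - 2 * (s ^+ 2 * t ^+ 2) + e2.
  have [h|h] := leP 0 (r2 ^+ 2 + s ^+ 2 - 2 * (s ^+ 2 * t ^+ 2)).
    by rewrite addr_ge0.
  suff : 2 * (s ^+ 2 * t ^+ 2) - (r2 ^+ 2 + s ^+ 2) <= e2 by lra.
  rewrite -(@ler_pXn2r _ 2)// ?nnegrE//; first last.
    by move: h; lra.
  rewrite e2E /D2 -subr_ge0.
  have -> : (r2 ^+ 2 + s ^+ 2) ^+ 2 - (2 * (r2 * s * t)) ^+ 2 -
     (2 * (s ^+ 2 * t ^+ 2) - (r2 ^+ 2 + s ^+ 2)) ^+ 2 =
     4 * ((s * t) ^+ 2 * (s ^+ 2 * (1 - t ^+ 2))) by ring.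
  apply: mulr_ge0 => //; apply: mulr_ge0; first exact: sqr_ge0.
  by apply: mulr_ge0; rewrite ?sqr_ge0// subr_ge0.
rewrite -subr_ge0.
have -> : (e2 + (r2 ^+ 2 - r1 ^+ 2)) ^+ 2 - D1 =
  2 * ((r2 ^+ 2 - r1 ^+ 2) * (r2 ^+ 2 + s ^+ 2 - 2 * (s ^+ 2 * t ^+ 2) + e2)).
  have -> : D1 = D1 + (e2 ^+ 2 - D2) by rewrite e2E subrr addr0.
  by rewrite /D1 /D2; ring.
by rewrite mulr_ge0// mulr_ge0.
Qed.

(** Each of the two square roots is the distance of a fixed point to a point that
    moves by [r2 - r1] along a line. *)
Lemma focal_mean_lip r1 r2 s t : 0 <= r1 -> r1 <= r2 -> 0 <= s ->
  0 <= t <= 1 -> focal_mean r2 s t <= focal_mean r1 s t + (r2 - r1).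
Proof.
move=> r10 r12 s0 t01; have r20 := le_trans r10 r12.
have d0 : 0 <= r2 - r1 by rewrite subr_ge0.
have t2 : t ^+ 2 <= 1 by rewrite expr_le1//; case/andP: t01.
have lip (e : R) : e ^+ 2 <= 1 -> 0 <= r1 ^+ 2 + s ^+ 2 + 2 * (r1 * s * e) ->
    Num.sqrt (r2 ^+ 2 + s ^+ 2 + 2 * (r2 * s * e)) <=
    Num.sqrt (r1 ^+ 2 + s ^+ 2 + 2 * (r1 * s * e)) + (r2 - r1).
  move=> e1 X0; set X := r1 ^+ 2 + _ + _.
  have sX : 0 <= Num.sqrt X by exact: sqrtr_ge0.
  have Xr : 0 <= Num.sqrt X + (r2 - r1) by exact: addr_ge0.
  rewrite -[leRHS](ger0_norm Xr) -sqrtr_sqr ler_wsqrtr//.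
  have XE : Num.sqrt X ^+ 2 = X by exact: sqr_sqrtr.
  have h : r1 + s * e <= Num.sqrt X.
    apply: le_trans (ler_norm _) _; rewrite -sqrtr_sqr ler_wsqrtr// /X -subr_ge0.
    have -> : r1 ^+ 2 + s ^+ 2 + 2 * (r1 * s * e) - (r1 + s * e) ^+ 2 =
       s ^+ 2 * (1 - e ^+ 2) by ring.
    by apply: mulr_ge0; rewrite ?sqr_ge0// subr_ge0.
  rewrite -subr_ge0.
  have -> : (Num.sqrt X + (r2 - r1)) ^+ 2 - (r2 ^+ 2 + s ^+ 2 + 2 * (r2 * s * e))
     = 2 * ((r2 - r1) * (Num.sqrt X - (r1 + s * e))).
    have -> : (Num.sqrt X + (r2 - r1)) ^+ 2 = X + (Num.sqrt X + (r2 - r1)) ^+ 2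
      - Num.sqrt X ^+ 2 by rewrite XE; ring.
    by rewrite /X; ring.
  by rewrite !mulr_ge0// subr_ge0.
have := lip t t2 (focal_sum_ge0 r10 s0 t01).
have := lip (- t); rewrite sqrrN => /(_ t2); rewrite !mulrN.
move/(_ (focal_disc_ge0 r10 s0 t01)); rewrite /focal_mean.
by lra.
Qed.

(** The increment of the averaged kernel [ln (focal_mean _ s t)] along the
    dilation of [r] from [expR (- h) * r] to [expR h * r]. *)
Definition focal_kernel h r s t : R :=
  ln (focal_mean (expR h * r) s t) - ln (focal_mean (expR (- h) * r) s t).

Let expRMNK h x : expR h * (expR (- h) * x) = x.
Proof. by rewrite mulrA -expRD subrr expR0 mul1r. Qed.

Lemma focal_meanEl h r s t :
  focal_mean (expR h * r) s t = expR h * focal_mean r (expR (- h) * s) t.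
Proof. by rewrite -focal_meanZ ?expR_ge0// expRMNK. Qed.

Lemma ln_focal_meanEl h r s t : 0 < r -> 0 <= s -> 0 <= t <= 1 ->
  ln (focal_mean (expR h * r) s t) = h + ln (focal_mean r (expR (- h) * s) t).
Proof.
move=> r0 s0 t01; rewrite focal_meanEl lnM ?posrE ?expR_gt0 ?expRK//.
by rewrite focal_mean_gt0// mulr_ge0// expR_ge0.
Qed.

Lemma focal_kernel_ge0 h r s t : 0 <= h -> 0 <= r -> 0 <= s -> 0 <= t <= 1 ->
  0 <= focal_kernel h r s t.
Proof.
move=> h0; rewrite le_eqVlt => /predU1P[<-|r0] s0 t01.
  by rewrite /focal_kernel !mulr0 subrr.
rewrite /focal_kernel subr_ge0 ler_ln ?posrE ?focal_mean_gt0 ?mulr_gt0 ?expR_gt0//.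
apply: focal_mean_homo => //; first by rewrite mulr_ge0 ?expR_ge0// ltW.
by rewrite ler_pM2r// ler_expR; lra.
Qed.

(** Dilating [r] by [expR h] is, up to a factor [expR h], the same as dilating
    [s] by [expR (- h)]; in the sum only the two factors [expR h] survive. *)
Lemma focal_kernel_sym h r s t : 0 < r -> 0 < s -> 0 <= t <= 1 ->
  focal_kernel h r s t + focal_kernel h s r t = 2 * h.
Proof.
move=> r0 s0 t01; rewrite /focal_kernel.
rewrite (ln_focal_meanEl h r0 (ltW s0))// (ln_focal_meanEl (- h) r0 (ltW s0))//.
rewrite opprK !(focal_meanC r); lra.
Qed.

Lemma focal_kernel_le h r s t : 0 <= h -> 0 <= r -> 0 <= s -> 0 <= t <= 1 ->
  focal_kernel h r s t <= 2 * h.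
Proof.
move=> h0; rewrite le_eqVlt => /predU1P[<-|r0].
  by move=> _ _; rewrite /focal_kernel !mulr0 subrr mulr_ge0.
rewrite le_eqVlt => /predU1P[<-|s0] t01; last first.
  rewrite -(focal_kernel_sym h r0 s0 t01) lerDl.
  by rewrite focal_kernel_ge0// ltW.
rewrite /focal_kernel !ln_focal_meanEl// !mulr0 focal_mean0 ?(ltW r0)//; lra.
Qed.

(** Far from the sphere of radius [s] the kernel is close to that of a unit mass
    at the origin, for which the increment is exactly [2 * h]. *)
Lemma focal_kernel_far h r s t : 0 <= h <= 1 / 2 -> 0 < r -> 0 <= s ->
  4 * s <= r -> 0 <= t <= 1 -> h <= focal_kernel h r s t.
Proof.
move=> /andP[h0 h1] r0 s0 sr t01.
rewrite /focal_kernel !ln_focal_meanEl// opprK.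
set X := focal_mean r (expR (- h) * s) t; set Y := focal_mean r (expR h * s) t.
have X0 : 0 < X by rewrite focal_mean_gt0// mulr_ge0// expR_ge0.
have Y0 : 0 < Y by rewrite focal_mean_gt0// mulr_ge0// expR_ge0.
have rX : r <= X.
  rewrite -(focal_mean0 t (ltW r0)) /X !(focal_meanC r).
  by apply: focal_mean_homo => //; rewrite ?mulr_ge0 ?expR_ge0// ltW.
have YX : Y <= X + (expR h * s - expR (- h) * s).
  rewrite /X /Y !(focal_meanC r); apply: focal_mean_lip => //.
  - by rewrite mulr_ge0 ?expR_ge0.
  - by rewrite ler_wpM2r// ler_expR; lra.
  - exact: ltW.
have eN : 1 - h <= expR (- h) by have := expR_ge1Dx (- h); lra.
have eP : expR h <= 1 + 2 * h.
  have e0 := expR_gt0 h.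
  have : expR h * expR (- h) = 1 by rewrite -expRD subrr expR0.
  nra.
have lnYX : ln Y - ln X <= 3 / 4 * h.
  rewrite -ln_div ?posrE//.
  have YX0 : 0 < Y / X by rewrite divr_gt0.
  have : ln (Y / X) <= Y / X - 1.
    by have := expR_ge1Dx (ln (Y / X)); rewrite lnK ?posrE//; lra.
  suff : Y / X <= 1 + 3 / 4 * h by lra.
  rewrite ler_pdivrMr//; nra.
lra.
Qed.

End focal_mean.

(** * Circle means of the logarithm *)

Section circle_mean.
Context (R : realType).
Local Notation mu := (@lebesgue_measure R).
Implicit Types (p q t C : R).

Lemma ge0_integral_translate (f : R -> \bar R) (a b c : R) :
  measurable_fun setT f -> (forall x, 0 <= f x)%E ->
  (\int[mu]_(x in `[(a + c)%R, (b + c)%R[) f x =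
   \int[mu]_(x in `[a, b[) f (x + c)%R)%E.
Proof.
move=> mf f0.
pose phi0 (x : measurableTypeR R) : measurableTypeR R := x + c.
have mphi : measurable_fun setT phi0 by exact: measurable_funD.
pose phi : {mfun measurableTypeR R >-> measurableTypeR R} :=
  HB.pack phi0 (isMeasurableFun.Build _ _ _ _ _ mphi).
have phiE i j u v : phi @^-1` [set` Interval (BSide i (u + c)) (BSide j (v + c))] =
    [set` Interval (BSide i u) (BSide j v)].
  apply/seteqP; split => x; rewrite /= /phi0 !in_itv/= !lteifD2r//.
transitivity (\int[pushforward mu phi]_(x in `[(a + c)%R, (b + c)%R[) f x)%E.
  apply: eq_measure_integral => A mA _.
  apply: lebesgue_measure_unique => // _ [[u v] _ <-].
  rewrite [RHS]/= /pushforward.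
  have := phiE false false (u - c) (v - c); rewrite !subrK => ->.
  rewrite !lebesgue_measure_itv/= !lte_fin ltrD2r -!EFinB.
  by rewrite opprD addrACA opprK addNr addr0.
rewrite ge0_integral_pushforward//; last by apply: measurable_funTS.
by rewrite phiE.
Qed.

Definition circ (b1 b2 t : R) : R := b1 * cos t + b2 * sin t.

Lemma circ_sqr (b1 b2 t : R) : circ b1 b2 t ^+ 2 <= b1 ^+ 2 + b2 ^+ 2.
Proof.
have E := cos2Dsin2 t.
have -> : b1 ^+ 2 + b2 ^+ 2 = (b1 ^+ 2 + b2 ^+ 2) * (cos t ^+ 2 + sin t ^+ 2).
  by rewrite E mulr1.
rewrite -subr_ge0.
have -> : (b1 ^+ 2 + b2 ^+ 2) * (cos t ^+ 2 + sin t ^+ 2) - circ b1 b2 t ^+ 2 =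
  (b1 * sin t - b2 * cos t) ^+ 2 by rewrite /circ; ring.
exact: sqr_ge0.
Qed.

Lemma circDpi (b1 b2 t : R) : circ b1 b2 (t + pi) = - circ b1 b2 t.
Proof. by rewrite /circ cosDpi sinDpi; ring. Qed.

Lemma measurable_circ b1 b2 : measurable_fun setT (circ b1 b2).
Proof.
apply: continuous_measurable_fun => x.
apply: cvgD; apply: cvgM; try exact: cvg_cst.
  exact: continuous_cos.
exact: continuous_sin.
Qed.

(** The frequency [2 ^+ k] compensates the length of the range, so that the
    argument of [circ] always describes one full turn; the constant [C] serves
    to keep the integrand nonnegative. *)
Definition circle_log (C p q b1 b2 : R) (k : nat) : \bar R :=
  (\int[mu]_(t in `[0%R, (2 * pi / 2 ^+ k)%R[)
     (C - ln (p ^+ 2 + q ^+ 2 - circ b1 b2 (2 ^+ k * t)))%:E)%E.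

Lemma circ_bounds (p q b1 b2 t : R) : 0 <= q < p ->
  b1 ^+ 2 + b2 ^+ 2 = (2 * (p * q)) ^+ 2 ->
  (p - q) ^+ 2 <= p ^+ 2 + q ^+ 2 - circ b1 b2 t <= (p + q) ^+ 2.
Proof.
move=> /andP[q0 qp] bE; have := circ_sqr b1 b2 t; rewrite bE => h.
have pq : 0 <= p * q by apply: mulr_ge0 => //; exact: ltW (le_lt_trans q0 qp).
have : `|circ b1 b2 t| <= 2 * (p * q).
  have pq2 : 0 <= 2 * (p * q) by apply: mulr_ge0.
  rewrite -(ger0_norm pq2).
  by rewrite -(@ler_pXn2r _ 2)// ?nnegrE// !real_normK// num_real.
rewrite ler_norml => /andP[h1 h2]; 
have -> : (p - q) ^+ 2 = p ^+ 2 + q ^+ 2 - 2 * (p * q) by ring.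
have -> : (p + q) ^+ 2 = p ^+ 2 + q ^+ 2 + 2 * (p * q) by ring.
by apply/andP; split; lra.
Qed.

Lemma circ_ln_bounds (p q b1 b2 t : R) : 0 <= q < p ->
  b1 ^+ 2 + b2 ^+ 2 = (2 * (p * q)) ^+ 2 ->
  2 * ln (p - q) <= ln (p ^+ 2 + q ^+ 2 - circ b1 b2 t) <= 2 * ln (p + q).
Proof.
move=> qp bE; have /andP[h1 h2] := circ_bounds t qp bE; case/andP: qp => q0 qp.
have pq0 : 0 < p - q by rewrite subr_gt0.
have pq0' : 0 < p + q by rewrite ltr_wpDr// (le_lt_trans q0).
have X0 : 0 < p ^+ 2 + q ^+ 2 - circ b1 b2 t.
  by apply: lt_le_trans h1; rewrite exprn_gt0.
by rewrite !mulr_natl -!lnXn// !ler_ln ?posrE ?exprn_gt0// h1 h2.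
Qed.

Lemma measurable_circ_log C A b1 b2 c :
  measurable_fun setT (fun t => (C - ln (A - circ b1 b2 (c * t)))%:E).
Proof.
apply/measurable_EFinP; apply: measurable_funB => //.
apply: (@measurableT_comp _ _ _ _ _ _ (@ln R) _ (fun t => A - circ b1 b2 (c * t))).
  exact: measurable_ln.
apply: measurable_funB => //.
apply: (@measurableT_comp _ _ _ _ _ _ (circ b1 b2) _ (fun t => c * t)).
  exact: measurable_circ.
exact: mulrl_measurable.
Qed.

(** Since [e_(t + pi) = - e_t], folding the circle onto its half multiplies the
    two factors, which doubles the angle and squares [p] and [q]. *)
Lemma circle_log_double (C p q b1 b2 : R) k : 0 <= q < p ->
  b1 ^+ 2 + b2 ^+ 2 = (2 * (p * q)) ^+ 2 -> 2 * ln (p + q) <= C ->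
  circle_log C p q b1 b2 k =
  circle_log (2 * C) (p ^+ 2) (q ^+ 2) ((b1 ^+ 2 - b2 ^+ 2) / 2) (b1 * b2) k.+1.
Proof.
move=> qp bE CE; rewrite /circle_log.
set L := 2 * pi / 2 ^+ k.+1.
have k0 : 2 ^+ k != 0 :> R by rewrite expf_neq0.
have LE : 2 * pi / 2 ^+ k = L + L by rewrite /L exprS; field.
have L0 : 0 < L by rewrite /L divr_gt0 ?mulr_gt0 ?pi_gt0 ?exprn_gt0.
rewrite LE.
pose f := fun t : R => (C - ln (p ^+ 2 + q ^+ 2 - circ b1 b2 (2 ^+ k * t)))%:E.
change (\int[mu]_(t in `[0%R, (L + L)%R[) f t = \int[mu]_(t in `[0%R, L[)
  (2 * C - ln ((p ^+ 2) ^+ 2 + (q ^+ 2) ^+ 2 -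
    circ ((b1 ^+ 2 - b2 ^+ 2) / 2) (b1 * b2) (2 ^+ k.+1 * t)))%:E)%E.
have mf : measurable_fun setT f by exact: measurable_circ_log.
have f0 t : (0 <= f t)%E.
  by rewrite lee_fin subr_ge0 (le_trans _ CE)//; case/andP: (circ_ln_bounds (2 ^+ k * t) qp bE).
have -> : `[0, L + L[%classic = `[0, L[%classic `|` `[(0 + L)%R, L + L[%classic.
  by rewrite add0r -itv_bndbnd_setU// bnd_simp; lra.
rewrite ge0_integral_setU//; last first.
- rewrite disj_set2E; apply/eqP/seteqP; split => // x /=.
  by rewrite add0r !in_itv/= => -[/andP[_ h] /andP[h' _]]; move: (lt_le_trans h h'); rewrite ltxx.
- exact: measurable_funTS.
rewrite ge0_integral_translate// -ge0_integralD//; last 2 first.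
- exact: measurable_funTS.
- apply: measurable_funTS; apply: (measurableT_comp mf).
  exact: measurable_funD.
apply: eq_integral => t _; rewrite /f -EFinD; congr EFin.
have -> : 2 ^+ k * (t + L) = 2 ^+ k * t + pi by rewrite /L exprS; field.
have -> : 2 ^+ k.+1 * t = 2 ^+ k * t + 2 ^+ k * t by rewrite exprS; ring.
set s := 2 ^+ k * t.
have /andP[h1 _] := circ_bounds s qp bE.
have /andP[h2 _] := circ_bounds (s + pi) qp bE.
have pq0 : 0 < (p - q) ^+ 2 by case/andP: qp => ? ?; rewrite exprn_gt0// subr_gt0.
have X0 := lt_le_trans pq0 h1.
have Y0 := lt_le_trans pq0 h2.
have -> : (p ^+ 2) ^+ 2 + (q ^+ 2) ^+ 2 -
    circ ((b1 ^+ 2 - b2 ^+ 2) / 2) (b1 * b2) (s + s) =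
  (p ^+ 2 + q ^+ 2 - circ b1 b2 s) * (p ^+ 2 + q ^+ 2 - circ b1 b2 (s + pi)).
  rewrite circDpi opprK -subr_sqr.
  have -> : circ b1 b2 s ^+ 2 = (b1 ^+ 2 + b2 ^+ 2) / 2 +
      circ ((b1 ^+ 2 - b2 ^+ 2) / 2) (b1 * b2) (s + s).
    rewrite /circ cosD sinD.
    have := cos2Dsin2 s => E.
    rewrite -[X in X / 2]mulr1 -[X in _ * X / 2]E; by field.
  by rewrite bE; field.
by rewrite lnM ?posrE//; ring.
Qed.

Lemma circle_log_bounds (C p q b1 b2 : R) k : 0 <= q < p ->
  b1 ^+ 2 + b2 ^+ 2 = (2 * (p * q)) ^+ 2 -> 2 * ln (p + q) <= C ->
  ((2 * pi / 2 ^+ k * (C - 2 * ln (p + q)))%:E <= circle_log C p q b1 b2 k <=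
   (2 * pi / 2 ^+ k * (C - 2 * ln (p - q)))%:E)%E.
Proof.
move=> qp bE CE; rewrite /circle_log.
set L := 2 * pi / 2 ^+ k.
have L0 : 0 < L by rewrite /L divr_gt0 ?mulr_gt0 ?pi_gt0 ?exprn_gt0.
have cstE (c : R) : (\int[mu]_(t in `[0%R, L[) (cst c%:E) t)%E = (L * c)%:E.
  rewrite integral_cst//= lebesgue_measure_itv/= lte_fin L0 oppr0 adde0.
  by rewrite muleC -EFinM.
have B t := circ_ln_bounds t qp bE.
have mf := @measurable_circ_log C (p ^+ 2 + q ^+ 2) b1 b2 (2 ^+ k).
rewrite -!cstE; apply/andP; split; apply: ge0_le_integral => //=.
- by move=> t _; rewrite lee_fin subr_ge0.
- exact: measurable_funTS.
- by move=> t _; rewrite lee_fin lerD2l lerN2; case/andP: (B (2 ^+ k * t)).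
- move=> t _; rewrite lee_fin subr_ge0 (le_trans _ CE)//.
  by case/andP: (B (2 ^+ k * t)).
- exact: measurable_funTS.
- by move=> t _; rewrite lee_fin lerD2l lerN2; case/andP: (B (2 ^+ k * t)).
Qed.

Lemma circle_log_iter (k : nat) : forall C p q b1 b2 (j : nat), 0 <= q < p ->
  b1 ^+ 2 + b2 ^+ 2 = (2 * (p * q)) ^+ 2 -> 2 * ln (p + q) <= C ->
  exists c1 c2 : R,
   [/\ c1 ^+ 2 + c2 ^+ 2 = (2 * (p ^+ (2 ^ k) * q ^+ (2 ^ k))) ^+ 2,
       2 * ln (p ^+ (2 ^ k) + q ^+ (2 ^ k)) <= 2 ^+ k * C &
       circle_log C p q b1 b2 j = circle_log (2 ^+ k * C) (p ^+ (2 ^ k))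
         (q ^+ (2 ^ k)) c1 c2 (j + k)].
Proof.
elim: k => [|k ih] C p q b1 b2 j qp bE CE.
  by exists b1, b2; rewrite !mul1r !expr1 addn0.
have /andP[q0 pq] := qp; have p0 := le_lt_trans q0 pq.
have qp2 : 0 <= q ^+ 2 < p ^+ 2 by rewrite sqr_ge0/= ltr_pXn2r// nnegrE ltW.
have bE2 : ((b1 ^+ 2 - b2 ^+ 2) / 2) ^+ 2 + (b1 * b2) ^+ 2 =
    (2 * (p ^+ 2 * q ^+ 2)) ^+ 2.
  have -> : ((b1 ^+ 2 - b2 ^+ 2) / 2) ^+ 2 + (b1 * b2) ^+ 2 =
    (b1 ^+ 2 + b2 ^+ 2) ^+ 2 / 4 by field.
  by rewrite bE; field.
have CE2 : 2 * ln (p ^+ 2 + q ^+ 2) <= 2 * C.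
  rewrite ler_pM2l//; apply: le_trans CE.
  rewrite mulr_natl -lnXn; last by rewrite ltr_wpDr.
  rewrite ler_ln ?posrE ?exprn_gt0 ?ltr_wpDr ?sqr_ge0 ?exprn_gt0//.
  by rewrite sqrrD lerD2r lerDl mulrn_wge0// mulr_ge0// ltW.
have [c1 [c2 [c1E cC cE]]] := ih _ _ _ _ _ j.+1 qp2 bE2 CE2.
have kE : 2 ^+ k.+1 * C = 2 ^+ k * (2 * C) by rewrite exprSr mulrA.
exists c1, c2; rewrite expnS !exprM kE; split=> //.
by rewrite (circle_log_double _ qp bE CE) cE addSnnS.
Qed.

(** The mean value property of [z |-> ln `|z|] in the plane: by repeated
    doubling, the circle mean for [p] and [q] is [N^-1] times that for [p ^ N]
    and [q ^ N], where the contribution of [q ^ N] is negligible. *)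
Lemma circle_log_mean (C p q b1 b2 : R) : 0 <= q < p ->
  b1 ^+ 2 + b2 ^+ 2 = (2 * (p * q)) ^+ 2 -> 2 * ln (p + q) <= C ->
  (\int[mu]_(t in `[0%R, (2 * pi)%R[)
     (C - ln (p ^+ 2 + q ^+ 2 - circ b1 b2 t))%:E =
   (2 * pi * (C - 2 * ln p))%:E)%E.
Proof.
move=> qp bE CE.
have -> : (\int[mu]_(t in `[0%R, (2 * pi)%R[)
     (C - ln (p ^+ 2 + q ^+ 2 - circ b1 b2 t))%:E)%E = circle_log C p q b1 b2 0.
  rewrite /circle_log expr0 divr1; apply: eq_integral => t _.
  by rewrite mul1r.
have /andP[q0 pq] := qp; have p0 := le_lt_trans q0 pq.
have pi0 : 0 < 2 * pi :> R by rewrite mulr_gt0 ?pi_gt0.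
have qp1 : 0 <= q / p < 1 by rewrite ltr_pdivrMr// mul1r pq divr_ge0// ltW.
have qpN0 : 0 < 1 - q / p by rewrite subr_gt0; case/andP: qp1.
(* [M / 2 ^+ k] bounds the error left after [k] doublings: it accounts for
   [(p ^+ N + q ^+ N) / p ^+ N <= 2] and
   [1 - q / p <= (p ^+ N - q ^+ N) / p ^+ N] with [N = 2 ^ k] *)
set M := 2 * pi * (2 * (ln 2 - ln (1 - q / p))).
have bnd k : ((2 * pi * (C - 2 * ln p) - M / 2 ^+ k)%:E <= circle_log C p q b1 b2 0 <=
    (2 * pi * (C - 2 * ln p) + M / 2 ^+ k)%:E)%E.
  have [c1 [c2 [c1E cC ->]]] := circle_log_iter k 0 qp bE CE.
  set N := (2 ^ k)%N in c1E cC *.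
  have N0 : (0 < N)%N by rewrite expn_gt0.
  have NE : 2 ^+ k = N%:R :> R by rewrite natrX.
  have N0' : 0 < N%:R :> R by rewrite ltr0n.
  have qpN : 0 <= q ^+ N < p ^+ N.
    by rewrite exprn_ge0//= ltr_pXn2r// nnegrE ltW.
  have pN0 : 0 < p ^+ N by rewrite exprn_gt0.
  have E : q ^+ N = p ^+ N * (q / p) ^+ N by rewrite -exprMn mulrC divfK// gt_eqF.
  have h1 : 0 <= (q / p) ^+ N <= q / p.
    case/andP: qp1 => h0 h1; rewrite exprn_ge0//=.
    by rewrite -[leRHS]expr1 ler_wiXn2l// ltW.
  case/andP: h1 => h1 h2.
  have ln1 : ln (p ^+ N + q ^+ N) <= N%:R * ln p + ln 2.
    rewrite mulr_natl -lnXn// -lnM ?posrE// ler_ln ?posrE ?mulr_gt0//.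
      by case/andP: qpN => ? ?; rewrite mulr_natr mulr2n lerD2l ltW.
    by case/andP: qpN => ? ?; rewrite ltr_wpDr.
  have ln2 : N%:R * ln p + ln (1 - q / p) <= ln (p ^+ N - q ^+ N).
    rewrite mulr_natl -lnXn// -lnM ?posrE// ler_ln ?posrE ?mulr_gt0//.
      by rewrite E -[X in _ <= X - _]mulr1 -mulrBr ler_pM2l// lerD2l lerN2.
    by rewrite subr_gt0; case/andP: qpN.
  have ln20 : 0 <= ln 2 :> R by rewrite ln_ge0// ler1n.
  have lnq : ln (1 - q / p) <= 0 by rewrite ln_le0// gerBl; case/andP: qp1.
  have /andP[b1' b2'] := circle_log_bounds (0 + k) qpN c1E cC.
  rewrite add0n NE in b1' b2' *; apply/andP; split.
    apply: le_trans b1'; rewrite lee_fin -subr_ge0.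
    have -> : 2 * pi / N%:R * (N%:R * C - 2 * ln (p ^+ N + q ^+ N)) -
       (2 * pi * (C - 2 * ln p) - M / N%:R) =
       2 * pi / N%:R * (2 * (N%:R * ln p + ln 2 - ln (p ^+ N + q ^+ N)) -
          2 * ln (1 - q / p)).
      by rewrite /M; field; rewrite !gt_eqF.
    by rewrite mulr_ge0//; [rewrite divr_ge0// ltW|lra].
  apply: le_trans b2' _; rewrite lee_fin -subr_ge0.
  have -> : 2 * pi * (C - 2 * ln p) + M / N%:R -
       2 * pi / N%:R * (N%:R * C - 2 * ln (p ^+ N - q ^+ N))
       = 2 * pi / N%:R * (2 * (ln (p ^+ N - q ^+ N) - (N%:R * ln p + ln (1 - q / p))) +
          2 * ln 2).
    by rewrite /M; field; rewrite !gt_eqF.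
  by rewrite mulr_ge0//; [rewrite divr_ge0// ltW|lra].
have cf : circle_log C p q b1 b2 0 \is a fin_num.
  by have /andP[h1 h2] := bnd 0%N; rewrite fin_numElt (lt_le_trans _ h1) ?ltNyr//= (le_lt_trans h2)// ltry.
rewrite -(fineK cf); congr EFin.
set x := fine _; set y := 2 * pi * _.
have M0 : 0 <= M.
  have := bnd 0%N; rewrite -(fineK cf) !lee_fin expr0 divr1 => /andP[]; rewrite -/x -/y.
  by lra.
have bnd2 k : `|x - y| <= M / 2 ^+ k.
  have := bnd k; rewrite -(fineK cf) !lee_fin -/x -/y => /andP[h1 h2].
  by rewrite ler_norml; apply/andP; split; lra.
apply/eqP; rewrite -subr_eq0 -normr_le0; apply/ler_addgt0Pr => e e0.
rewrite add0r.
have Me : M / e < (Num.truncn (M / e)).+1%:R by exact: truncnS_gt.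
set k := (Num.truncn _).+1 in Me; apply: le_trans (bnd2 k) _.
rewrite ler_pdivrMr ?exprn_gt0// -ler_pdivrMl// mulrC (le_trans (ltW Me))//.
by rewrite -natrX ler_nat ltnW// ltn_expl.
Qed.

End circle_mean.

(** * Dilations of Lebesgue measure *)

Section dilation.
Context (R : realType).
Local Open Scope ereal_scope.

Lemma lebesgue_measure_dilation (a : R) (A : set R) : (0 < a)%R ->
  measurable A -> a%:E * lebesgue_measure (( *%R a) @^-1` A) = lebesgue_measure A.
Proof.
move=> a0 mA.
pose phi0 (x : measurableTypeR R) : measurableTypeR R := (a * x)%R.
have mphi : measurable_fun setT phi0 by exact: mulrl_measurable.
pose phi : {mfun measurableTypeR R >-> measurableTypeR R} :=
  HB.pack phi0 (isMeasurableFun.Build _ _ _ _ _ mphi).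
pose a' : {nonneg R} := NngNum (ltW a0).
rewrite [RHS](@lebesgue_measure_unique _ (mscale a' (pushforward lebesgue_measure phi)))//.
move=> _ [[u v] _ <-].
change (lebesgue_measure `]u, v] = a%:E * lebesgue_measure (phi @^-1` `]u, v])).
have -> : phi @^-1` `]u, v] = `](u / a)%R, (v / a)%R]%classic.
  apply/seteqP; split => x; rewrite /= /phi0 !in_itv/= (mulrC a).
    by rewrite ltr_pdivrMr// ler_pdivlMr.
  by rewrite ltr_pdivrMr// ler_pdivlMr.
rewrite !lebesgue_measure_itv/= !lte_fin ltr_pM2r ?invr_gt0//.
case: ifPn => uv; last by rewrite mule0.
by rewrite -!EFinB -EFinM -mulrBl mulrC divfK// gt_eqF.
Qed.

Lemma measurable_tscale n (a : R) : measurable_fun setT (@tscale R n a).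
Proof.
apply/measurable_fun_tnthP => i.
rewrite (_ : _ \o _ = fun x : n.-tuple R => (a * tnth x i)%R); last first.
  by apply/funext => x /=; rewrite tnth_mktuple.
by apply: measurable_funM => //; exact: measurable_tnth.
Qed.

Lemma lebesgue_tuple_dilation n (a : R) (A : set (n.-tuple R)) : (0 < a)%R ->
  measurable A ->
  (a ^+ n)%:E * lebesgue_tuple n (tscale a @^-1` A) = lebesgue_tuple n A.
Proof.
move=> a0; elim: n A => [|n ih] A mA.
  rewrite expr0 mul1e /= !diracE; congr (_%:R%:E); congr nat_of_bool.
  by apply: asbool_equiv_eq => /=; rewrite [tscale _ _]tuple0.
pose S0 (x : measurableTypeR R * n.-tuple R) : measurableTypeR R * n.-tuple R :=
  ((a * x.1)%R, tscale a x.2).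
have mS0 : measurable_fun setT S0.
  apply: measurable_fun_pair.
    by apply: (@measurableT_comp _ _ _ _ _ _ ( *%R a)) => //; exact: mulrl_measurable.
  by apply: (measurableT_comp (@measurable_tscale n a)).
pose S : {mfun (measurableTypeR R * n.-tuple R)%type >-> (measurableTypeR R * n.-tuple R)%type} :=
  HB.pack S0 (isMeasurableFun.Build _ _ _ _ _ mS0).
pose a' : {nonneg R} := NngNum (exprn_ge0 n.+1 (ltW a0)).
have mtA : measurable (@tcons R n @^-1` A).
  by rewrite -[X in measurable X]setTI; exact: measurable_tcons.
rewrite [RHS]/= /pushforward.
rewrite [RHS](product_measure_unique (m' := mscale a'
   (pushforward (lebesgue_measure \x lebesgue_tuple n) S)))//.
  rewrite /mscale /= /pushforward; congr (_ * (_ \x _) _).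
  apply/seteqP; split => -[x s] /=; rewrite /S0/=.
    congr (A _); apply: eq_from_tnth => i; rewrite tnth_mktuple.
    by case: (unliftP ord0 i) => [j ->|->]; rewrite ?tnthS ?tnth_mktuple//.
  congr (A _); apply: eq_from_tnth => i; rewrite tnth_mktuple.
  by case: (unliftP ord0 i) => [j ->|->]; rewrite ?tnthS ?tnth_mktuple//.
move=> B C mB mC.
change ((a ^+ n.+1)%:E * (lebesgue_measure \x lebesgue_tuple n)
  ((( *%R a) @^-1` B) `*` (tscale a @^-1` C)) =
  lebesgue_measure B * lebesgue_tuple n C).
have maB : measurable (( *%R a) @^-1` B).
  by rewrite -[X in measurable X]setTI; apply: mulrl_measurable.
have maC : measurable (@tscale R n a @^-1` C).
  by rewrite -[X in measurable X]setTI; exact: measurable_tscale.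
rewrite product_measure1E// -(lebesgue_measure_dilation a0 mB) -(ih _ mC).
by rewrite exprS EFinM muleACA.
Qed.

Lemma ge0_integral_dilation n (a : R) (f : n.-tuple R -> \bar R) : (0 < a)%R ->
  measurable_fun setT f -> (forall x, 0 <= f x) ->
  (a ^+ n)%:E * \int[lebesgue_tuple n]_x f (tscale a x) =
  \int[lebesgue_tuple n]_x f x.
Proof.
move=> a0 mf f0.
have mS := @measurable_tscale n a.
pose a' : {nonneg R} := NngNum (exprn_ge0 n (ltW a0)).
rewrite -[X in _ * X = _]/(\int[lebesgue_tuple n]_(x in tscale a @^-1` setT)
  (f \o tscale a) x) -(ge0_integral_pushforward mS)//.
pose m : {measure set (n.-tuple R) -> \bar R} :=
  measure_function_pushforward__canonical__measure_function_Measure (lebesgue_tuple n) mS.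
rewrite -(@ge0_integral_mscale _ _ _ m _ measurableT a')//.
apply: eq_measure_integral => A mA _.
by rewrite /mscale/= /pushforward -(lebesgue_tuple_dilation a0).
Qed.

End dilation.

(** * Balls, spheres and polar coordinates *)

Section polar.
Context (R : realType) (n : nat).
Local Open Scope ereal_scope.
Implicit Types x y : n.-tuple R.
Local Notation m := (@lebesgue_tuple R n).

Lemma enorm_ge0 x : (0 <= enorm x)%R.
Proof. exact: sqrtr_ge0. Qed.

Definition eball (r : R) : set (n.-tuple R) := [set x | (enorm x < r)%R].

Lemma measurable_eball r : measurable (eball r).
Proof.
rewrite (_ : eball r = @enorm R n @^-1` `]-oo, r[).
  by rewrite -[X in measurable X]setTI; exact: measurable_enorm.
by apply/seteqP; split => x; rewrite /eball /= in_itv.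
Qed.

Definition dilation_invariant (C : set (n.-tuple R)) :=
  forall (a : R) x, (0 < a)%R -> C (tscale a x) <-> C x.

Lemma lebesgue_tuple_eballI r (C : set (n.-tuple R)) : (0 < r)%R ->
  measurable C -> dilation_invariant C ->
  m (eball r `&` C) = (r ^+ n)%:E * m (eball 1 `&` C).
Proof.
move=> r0 mC iC.
rewrite -(lebesgue_tuple_dilation r0); last first.
  by apply: measurableI => //; exact: measurable_eball.
congr (_ * m _); apply/seteqP; split => x; rewrite /eball/= enorm_scale ?ltW//.
  move=> [h /iC hC]; split; last exact: hC.
  by rewrite -(ltr_pM2l r0) mulr1.
move=> [h hC]; split; last by apply/iC.
by rewrite -[X in (_ < X)%R]mulr1 ltr_pM2l.
Qed.

Lemma lebesgue_tuple_eball r : (0 < r)%R ->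
  m (eball r) = (r ^+ n)%:E * m (eball 1).
Proof.
by move=> r0; have := @lebesgue_tuple_eballI r setT r0 measurableT; rewrite !setIT; apply.
Qed.

(** The origin is a box with degenerate sides. *)
Lemma lebesgue_tuple_origin : (0 < n)%N -> m [set x | enorm x = 0%R] = 0.
Proof.
case: n => // k _.
rewrite (_ : [set _ | _] = [set x : k.+1.-tuple R | forall i, [set 0%R] (tnth x i)]).
  rewrite (@lebesgue_tuple_box R k.+1 (fun=> [set 0%R])).
    by rewrite big_ord_recl lebesgue_measure_set1 mul0e.
  by move=> _; exact: measurable_set1.
apply/seteqP; split => x /= h.
  move=> i; apply/eqP; rewrite -normr_le0.
  by apply: le_trans (ler_tnth_enorm x i) _; rewrite h.
by rewrite /enorm big1 ?sqrtr0// => i _; rewrite h expr0n.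
Qed.

Lemma measurable_enorm_eq r : measurable [set x : n.-tuple R | enorm x = r].
Proof.
rewrite (_ : [set _ | _] = @enorm R n @^-1` [set r])//.
by rewrite -[X in measurable X]setTI; apply: measurable_enorm.
Qed.

Lemma lebesgue_tuple_eball1 : (0 < n)%N -> 0 < m (eball 1) < +oo.
Proof.
move=> n0; have /andP[] := @sphere_measure_unit_sphere_bounds R n n0.
rewrite /sphere_measure cone_unit_sphere; set B := [set x | _] => B0 Boo.
have mB : measurable B.
  rewrite (_ : B = @enorm R n @^-1` `]0%R, 1%R]).
    by rewrite -[X in measurable X]setTI; exact: measurable_enorm.
  by apply/seteqP; split => x; rewrite /B /= in_itv.
have n0' : (0 < n%:R :> R)%R by rewrite ltr0n.
have {}B0 : 0 < m B by move: B0; rewrite pmule_rgt0 ?lte_fin.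
have {}Boo : m B < +oo.
  rewrite ltey; apply/eqP => E; move: Boo; rewrite E gt0_muley ?lte_fin//.
have m2 : m B <= m (eball 2).
  apply: le_measure; rewrite ?inE//; first exact: measurable_eball.
  by move=> x /= /andP[_ h]; apply: le_lt_trans h _; rewrite ltr1n.
rewrite lebesgue_tuple_eball// in m2.
apply/andP; split.
  rewrite lt0e measure_ge0 andbT; apply/eqP => E; move: m2.
  by rewrite E mule0 leNgt B0.
apply: (@le_lt_trans _ _ (m (B `|` [set x | enorm x = 0%R]))).
  apply: le_measure; rewrite ?inE//; first exact: measurable_eball.
    by apply: measurableU => //; exact: measurable_enorm_eq.
  move=> x /= h; have := enorm_ge0 x; rewrite le_eqVlt => /predU1P[<-|x0]; first by right.
  by left; rewrite /B /= x0 ltW.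
apply: le_lt_trans (measureU2 _ _ _) _ => //; first exact: measurable_enorm_eq.
change (m B + m [set x | enorm x = 0%R] < +oo).
by rewrite lebesgue_tuple_origin// adde0.
Qed.

(** By homogeneity the volume of a ball is a continuous function of its radius,
    so the shells around the sphere have arbitrarily small volume. *)
Lemma lebesgue_tuple_sphere r : (0 < n)%N -> m [set x | enorm x = r] = 0.
Proof.
move=> n0; have /andP[c0 coo] := lebesgue_tuple_eball1 n0.
have [r0|r0|->] := ltgtP r 0%R; last exact: lebesgue_tuple_origin.
  rewrite (_ : [set x | _] = set0) ?measure0//; apply/seteqP; split => x //= h.
  by have := enorm_ge0 x; rewrite h leNgt r0.
have cf : m (eball 1) \is a fin_num by rewrite ge0_fin_numE// ltW.
set c := fine (m (eball 1)).
have cE : m (eball 1) = c%:E by rewrite fineK.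
have {}c0 : (0 < c)%R by rewrite -lte_fin -cE.
have up (t : R) : (r < t)%R -> m [set x | enorm x = r] <= (c * (t ^+ n - r ^+ n))%:E.
  move=> rt; have t0 := lt_trans r0 rt.
  have : m [set x | enorm x = r] + m (eball r) <= m (eball t).
    rewrite -measureU//; last 3 first.
    - exact: measurable_enorm_eq.
    - exact: measurable_eball.
    - by apply/seteqP; split => x //= [E]; rewrite /eball /= E ltxx.
    apply: le_measure; rewrite ?inE//.
    - by apply: measurableU; [exact: measurable_enorm_eq|exact: measurable_eball].
    - exact: measurable_eball.
    - by move=> x [/= E|/= h]; [rewrite /eball /= E|exact: lt_trans h rt].
  rewrite (lebesgue_tuple_eball t0) (lebesgue_tuple_eball r0) cE -leeBrDr//.
  move=> h; apply: le_trans h _.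
  by rewrite -!EFinM -EFinB lee_fin mulrBr [X in (X - _)%R]mulrC [X in (_ - X)%R]mulrC.
apply/eqP; rewrite eq_le measure_ge0 andbT.
have : (fun t : R => (c * (t ^+ n - r ^+ n))%R) t @[t --> r^'+] --> (c * (r ^+ n - r ^+ n))%R.
  apply: cvg_at_right_filter; apply: cvgMr; apply: cvgB; last exact: cvg_cst.
  exact: exprn_continuous.
rewrite subrr mulr0 => lim.
have mf : m [set x | enorm x = r] \is a fin_num.
  have r1 : (r < r + 1)%R by rewrite ltrDl.
  rewrite ge0_fin_numE ?measure_ge0//.
  by apply: le_lt_trans (up _ r1) _; rewrite ltry.
rewrite -(fineK mf) lee_fin.
set y := fine _.
apply: (closed_cvg (fun z => (y <= z)%R) (@closed_ge _ y) _ 0%R lim).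
near=> t; have rt : (r < t)%R by near: t; exact: nbhs_right_gt.
by have := up t rt; rewrite -(fineK mf) lee_fin.
Unshelve. all: by end_near. Qed.

Lemma ae_enorm_neq (r : R) (P : n.-tuple R -> Prop) : (0 < n)%N ->
  (forall y, enorm y != r -> P y) -> {ae m, forall y, P y}.
Proof.
move=> n0 h; exists [set y | enorm y = r]; split.
- exact: measurable_enorm_eq.
- exact: lebesgue_tuple_sphere.
- by move=> y /= yP; apply: contrapT => /eqP yr; apply: yP; exact: h.
Qed.

(** Polar coordinates reduced to a dilation invariant set [C]: by homogeneity
    both sides agree when [A] is a half-line [`]-oo, r[], and such half-lines
    generate the Borel sets. *)
Lemma lebesgue_tuple_polar_indep (A : set R) (C : set (n.-tuple R)) :
  (0 < n)%N -> measurable A -> measurable C -> dilation_invariant C ->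
  m (eball 1) * m ([set x | A (enorm x)] `&` C) =
  m (eball 1 `&` C) * m [set x | A (enorm x)].
Proof.
move=> n0 mA mC iC; have /andP[c0 coo] := lebesgue_tuple_eball1 n0.
have cf : m (eball 1) \is a fin_num by rewrite ge0_fin_numE// ltW.
have mI : measurable (eball 1 `&` C).
  by apply: measurableI => //; exact: measurable_eball.
have cCoo : m (eball 1 `&` C) < +oo.
  by apply: le_lt_trans coo; apply: le_measure; rewrite ?inE//; exact: measurable_eball.
have cCf : m (eball 1 `&` C) \is a fin_num by rewrite ge0_fin_numE.
pose k1 : {nonneg R} := NngNum (fine_ge0 (measure_ge0 m (eball 1))).
pose k2 : {nonneg R} := NngNum (fine_ge0 (measure_ge0 m (eball 1 `&` C))).
have me := @measurable_enorm R n : measurable_fun setT (@enorm R n).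
pose p1 : {measure set R -> \bar R} :=
  measure_function_pushforward__canonical__measure_function_Measure (mrestr m mC) me.
pose p2 : {measure set R -> \bar R} :=
  measure_function_pushforward__canonical__measure_function_Measure m me.
have p1E r : mscale k1 p1 r = m (eball 1) * m ([set x | r (enorm x)] `&` C).
  by rewrite /mscale /= fineK.
have p2E r : mscale k2 p2 r = m (eball 1 `&` C) * m [set x | r (enorm x)].
  by rewrite /mscale /= fineK.
rewrite -p1E -p2E.
have ballE r : [set x | `]-oo, r[%classic (enorm x)] = eball r.
  by apply/seteqP; split => x; rewrite /eball /= in_itv.
apply: (measure_unique (@RGenInftyO.G R) (fun k => `]-oo, k%:R[%classic)) => //.
- exact: RGenInftyO.measurableE.
- move=> _ _ [x ->] [y ->]; exists (Num.min x y).
  by apply/seteqP; split => z; rewrite /= !in_itv/= lt_min => /andP.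
- by move=> k; exists k%:R.
- apply/seteqP; split => // x _; exists (Num.truncn x).+1 => //=.
  by rewrite in_itv/= truncnS_gt.
- move=> _ [r ->]; rewrite [LHS]p1E [RHS]p2E ballE.
  have [r0|r0] := ltP 0%R r.
    rewrite (lebesgue_tuple_eballI r0 mC iC) (lebesgue_tuple_eball r0).
    by rewrite [LHS]muleCA [RHS]muleCA; congr (_ * _); exact: muleC.
  have -> : eball r = set0.
    by apply/seteqP; split => x //=; rewrite /eball /= ltNge (le_trans r0)// enorm_ge0.
  by rewrite set0I measure0 !mule0.
- move=> k; rewrite [X in X < _]p1E ballE; case: k => [|k].
    rewrite (_ : eball 0 = set0) ?set0I ?measure0 ?mule0//.
    by apply/seteqP; split => x //=; rewrite /eball /= ltNge enorm_ge0.
  by rewrite lebesgue_tuple_eballI// lte_mul_pinfty// lte_mul_pinfty// lee_fin exprn_ge0.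
Qed.

(** A dilation invariant variable [tau] is independent of the radius.  The
    measure [kappa], the restriction of Lebesgue measure to the unit ball, is
    not normalized, whence the factor on the left. *)
Lemma ge0_integral_polar (tau : n.-tuple R -> R) :
  (0 < n)%N -> measurable_fun setT tau ->
  (forall (a : R) x, (0 < a)%R -> tau (tscale a x) = tau x) ->
  exists kappa : {finite_measure set (n.-tuple R) -> \bar R},
    forall F : R * R -> \bar R, measurable_fun setT F -> (forall z, 0 <= F z) ->
    m (eball 1) * \int[m]_x F (enorm x, tau x) =
    \int[m]_x \int[kappa]_y F (enorm x, tau y).
Proof.
move=> n0 mtau itau; have /andP[c0 coo] := lebesgue_tuple_eball1 n0.
have cf : m (eball 1) \is a fin_num by rewrite ge0_fin_numE// ltW.
have mB := measurable_eball 1.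
have me := @measurable_enorm R n : measurable_fun setT (@enorm R n).
pose k1 : {nonneg R} := NngNum (fine_ge0 (measure_ge0 m (eball 1))).
pose g x : R * R := (enorm x, tau x).
have mg : measurable_fun setT g by exact: measurable_fun_pair.
pose h (z : n.-tuple R * n.-tuple R) : R * R := (enorm z.1, tau z.2).
have mh : measurable_fun setT h.
  by apply: measurable_fun_pair; apply: measurableT_comp.
pose mB' : {finite_measure set (n.-tuple R) -> \bar R} := mfrestr mB coo.
pose p1 : {measure set (R * R) -> \bar R} :=
  measure_function_pushforward__canonical__measure_function_Measure m mg.
pose p2 : {measure set (R * R) -> \bar R} :=
  measure_function_pushforward__canonical__measure_function_Measure (m \x mB')%E mh.
have p12 A : measurable A -> mscale k1 p1 A = p2 A.
  move=> mA; pose G : set (set (R * R)) :=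
    [set X | exists A, measurable A /\ exists B, measurable B /\ X = A `*` B].
  have p1E (A' B' : set R) : mscale k1 p1 (A' `*` B') =
      m (eball 1) * m ([set x | A' (enorm x)] `&` tau @^-1` B').
    by rewrite /mscale /= fineK.
  have mpre (f : n.-tuple R -> R) (X : set R) : measurable_fun setT f ->
      measurable X -> measurable (f @^-1` X).
    by move=> mf mX; rewrite -[X in measurable X]setTI; exact: mf.
  apply: (measure_unique G (fun k => `]-oo, k%:R[%classic `*` setT)) => //.
  - rewrite measurable_prod_measurableType //; congr (<<s _ >>).
    rewrite predeqE; split => [[A1 mA1 [B1 mB1 <-]]|[A1 [mA1 [B1 [mB1 ->]]]]].
      by exists A1; split => //; exists B1.
    by exists A1 => //; exists B1.
  - move=> _ _ [X1 [mX1 [X2 [mX2 ->]]]] [Y1 [mY1 [Y2 [mY2 ->]]]].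
    rewrite -setXI; exists (X1 `&` Y1); split; first exact: measurableI.
    by exists (X2 `&` Y2); split => //; exact: measurableI.
  - by move=> k; exists `]-oo, k%:R[%classic; split => //; exists setT.
  - apply/seteqP; split => // -[x y] _; exists (Num.truncn x).+1 => //=.
    by rewrite in_itv/= truncnS_gt.
  - move=> _ [A1 [mA1 [B1 [mB1 ->]]]]; rewrite [LHS]p1E.
    rewrite lebesgue_tuple_polar_indep//; last 2 first.
    + exact: mpre.
    + by move=> a x a0; rewrite /= itau.
    transitivity ((m \x mB')%E (@enorm R n @^-1` A1 `*` tau @^-1` B1)); last by [].
    rewrite product_measure1E//; [|exact: mpre|exact: mpre].
    by rewrite muleC; congr (_ * _); rewrite setIC.
  - move=> k; rewrite [X in X < _]p1E preimage_setT setIT.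
    rewrite (_ : [set x | _] = eball k%:R); last first.
      by apply/seteqP; split => x; rewrite /eball /= in_itv.
    case: k => [|k].
      rewrite (_ : eball 0 = set0) ?measure0 ?mule0//.
      by apply/seteqP; split => x //=; rewrite /eball /= ltNge enorm_ge0.
    rewrite (lebesgue_tuple_eball (ltr0Sn _ _)).
    by rewrite lte_mul_pinfty// lte_mul_pinfty// lee_fin exprn_ge0.
exists mB' => F mF F0.
transitivity (\int[mscale k1 p1]_z F z).
  rewrite (@ge0_integral_mscale _ _ _ p1 _ measurableT k1)//.
  by rewrite (ge0_integral_pushforward mg)//= fineK.
transitivity (\int[p2]_z F z).
  by apply: eq_measure_integral => A mA _; exact: p12.
rewrite (ge0_integral_pushforward mh)// preimage_setT.
have mFh : measurable_fun setT (F \o h) by exact: measurableT_comp.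
by rewrite (fubini_tonelli1 _ mFh)// => z; exact: F0.
Qed.

End polar.

(** * Averaging over a circle in a coordinate plane *)

Section coordinate_plane.
Context (R : realType) (n : nat) (i0 i1 : 'I_n).
Hypothesis i01 : i0 != i1.
Implicit Types (x y : n.-tuple R) (t : R).
Local Notation m := (@lebesgue_tuple R n).

Definition plane_norm x : R := Num.sqrt (tnth x i0 ^+ 2 + tnth x i1 ^+ 2).

Definition plane_ratio x : R := plane_norm x / enorm x.

Definition circle_pt t (a : R) : n.-tuple R :=
  [tuple if i == i0 then t * cos a else if i == i1 then t * sin a else 0 | i < n].

Lemma sum_plane (F : 'I_n -> R) :
  \sum_i F i = F i0 + F i1 + \sum_(i | (i != i0) && (i != i1)) F i.
Proof. by rewrite (bigD1 i0)//= (bigD1 i1) 1?eq_sym//= addrA. Qed.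

Lemma enorm_sqr x : enorm x ^+ 2 = \sum_i tnth x i ^+ 2.
Proof. by rewrite sqr_sqrtr// sumr_ge0// => i _; exact: sqr_ge0. Qed.

Lemma plane_norm_sqr x : plane_norm x ^+ 2 = tnth x i0 ^+ 2 + tnth x i1 ^+ 2.
Proof. by rewrite sqr_sqrtr// addr_ge0// sqr_ge0. Qed.

Lemma plane_norm_le x : plane_norm x <= enorm x.
Proof.
rewrite -(@ler_pXn2r _ 2)// ?nnegrE ?sqrtr_ge0// plane_norm_sqr enorm_sqr sum_plane.
by rewrite lerDl sumr_ge0// => i _; exact: sqr_ge0.
Qed.

Lemma plane_ratio01 x : 0 <= plane_ratio x <= 1.
Proof.
rewrite /plane_ratio divr_ge0 ?sqrtr_ge0//=.
have := enorm_ge0 x; rewrite le_eqVlt => /predU1P[<-|x0].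
  by rewrite invr0 mulr0.
by rewrite ler_pdivrMr// mul1r plane_norm_le.
Qed.

Lemma plane_ratioM x : enorm x * plane_ratio x = plane_norm x.
Proof.
have := enorm_ge0 x; rewrite le_eqVlt => /predU1P[x0|x0].
  have := plane_norm_le x; rewrite -x0 mul0r => h.
  by apply/eqP; rewrite eq_le h sqrtr_ge0.
by rewrite /plane_ratio mulrC divfK// gt_eqF.
Qed.

Lemma plane_ratio_dilation a x : 0 < a -> plane_ratio (tscale a x) = plane_ratio x.
Proof.
move=> a0; rewrite /plane_ratio enorm_scale ?ltW//.
have -> : plane_norm (tscale a x) = a * plane_norm x.
  rewrite /plane_norm !tnth_mktuple !exprMn -mulrDr sqrtrM ?sqr_ge0//.
  by rewrite sqrtr_sqr gtr0_norm.
by rewrite -mulf_div divff ?mul1r// gt_eqF.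
Qed.

Lemma measurable_sqrtr : measurable_fun setT (@Num.sqrt R).
Proof. by apply: continuous_measurable_fun; exact: sqrt_continuous. Qed.

Lemma measurable_plane_norm : measurable_fun setT plane_norm.
Proof.
apply: (@measurableT_comp _ _ _ _ _ _ (@Num.sqrt R) _
  (fun x => tnth x i0 ^+ 2 + tnth x i1 ^+ 2)); first exact: measurable_sqrtr.
by apply: measurable_funD; apply: measurable_funX; exact: measurable_tnth.
Qed.

Lemma measurable_plane_ratio : measurable_fun setT plane_ratio.
Proof.
rewrite (_ : plane_ratio = fun x => plane_norm x * (enorm x `^ (-1))); last first.
  by apply/funext => x; rewrite /plane_ratio powR_inv1// enorm_ge0.
apply: measurable_funM; first exact: measurable_plane_norm.
apply: (@measurableT_comp _ _ _ _ _ _ (@powR R ^~ (-1))).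
  exact: measurable_powR.
exact: measurable_enorm.
Qed.

Lemma enorm_circle_pt_norm t a : enorm (circle_pt t a) = `|t|.
Proof.
rewrite -sqrtr_sqr /enorm; congr Num.sqrt.
rewrite sum_plane !tnth_mktuple eqxx eq_sym (negbTE i01) eqxx.
rewrite big1 => [|i /andP[h1 h2]]; last first.
  by rewrite tnth_mktuple (negbTE h1) (negbTE h2) expr0n.
by rewrite addr0 !exprMn -mulrDr cos2Dsin2 mulr1.
Qed.

Lemma enorm_circle_pt t a : 0 <= t -> enorm (circle_pt t a) = t.
Proof. by move=> t0; rewrite enorm_circle_pt_norm ger0_norm. Qed.

Lemma enorm_circle_ptB t a y :
  enorm (tsub (circle_pt t a) y) ^+ 2 = t ^+ 2 + enorm y ^+ 2 -
    circ (2 * t * tnth y i0) (2 * t * tnth y i1) a.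
Proof.
rewrite !enorm_sqr !sum_plane !tnth_mktuple eqxx eq_sym (negbTE i01) eqxx.
rewrite [X in _ + X = _](eq_bigr (fun i => tnth y i ^+ 2)) => [|i /andP[h1 h2]]; last first.
  by rewrite !tnth_mktuple (negbTE h1) (negbTE h2) sub0r sqrrN.
have -> : t ^+ 2 = t ^+ 2 * (cos a ^+ 2 + sin a ^+ 2) by rewrite cos2Dsin2 mulr1.
by rewrite /circ; ring.
Qed.


Local Notation lnp t y := (ln (focal_mean t (enorm y) (plane_ratio y))).

Lemma circ_plane_le t a y : 0 <= t ->
  `|circ (2 * t * tnth y i0) (2 * t * tnth y i1) a| <= 2 * (t * enorm y).
Proof.
move=> t0; have ty2 : 0 <= 2 * (t * enorm y).
  by apply: mulr_ge0 => //; apply: mulr_ge0 => //; exact: enorm_ge0.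
rewrite -(ger0_norm ty2) -(@ler_pXn2r _ 2)// ?nnegrE// !real_normK// ?num_real//.
apply: le_trans (circ_sqr _ _ _) _.
have -> : (2 * t * tnth y i0) ^+ 2 + (2 * t * tnth y i1) ^+ 2 =
  (2 * t) ^+ 2 * plane_norm y ^+ 2 by rewrite plane_norm_sqr; ring.
rewrite mulrA [leRHS]exprMn; apply: ler_wpM2l; first exact: sqr_ge0.
by rewrite ler_pXn2r// ?nnegrE ?sqrtr_ge0// plane_norm_le.
Qed.

Lemma enorm_circle_ptB_le t a y : 0 <= t ->
  enorm (tsub (circle_pt t a) y) <= t + enorm y.
Proof.
move=> t0; have ty : 0 <= t + enorm y by rewrite addr_ge0// enorm_ge0.
rewrite -(@ler_pXn2r _ 2)// ?nnegrE ?enorm_ge0// enorm_circle_ptB.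
have := circ_plane_le a y t0; rewrite ler_norml => /andP[h1 h2].
have -> : (t + enorm y) ^+ 2 = t ^+ 2 + enorm y ^+ 2 + 2 * (t * enorm y) by ring.
by lra.
Qed.

Lemma enorm_circle_ptB_gt0 t a y : 0 < t -> enorm y != t ->
  0 < enorm (tsub (circle_pt t a) y).
Proof.
move=> t0 yt; rewrite lt_neqAle enorm_ge0 andbT eq_sym -sqrf_eq0.
rewrite enorm_circle_ptB gt_eqF// subr_gt0.
apply: le_lt_trans (ler_norm _) _; apply: le_lt_trans (circ_plane_le a y (ltW t0)) _.
have h : 0 < (enorm y - t) ^+ 2 by rewrite lt_neqAle sqr_ge0 andbT eq_sym sqrf_eq0 subr_eq0.
have -> : 2 * (t * enorm y) = t ^+ 2 + enorm y ^+ 2 - (enorm y - t) ^+ 2 by ring.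
by rewrite gtrBl.
Qed.

Lemma two_pi_gt0 : 0 < 2 * pi :> R.
Proof. by rewrite mulr_gt0 ?pi_gt0. Qed.

Local Notation P := (uniform_prob two_pi_gt0).

Lemma measurable_ln_circle_pt (c t : R) y :
  measurable_fun setT (fun a => (c - ln (enorm (tsub (circle_pt t a) y)))%:E).
Proof.
apply/measurable_EFinP; apply: measurable_funB => //.
apply: (@measurableT_comp _ _ _ _ _ _ (@ln R) _
  (fun a => enorm (tsub (circle_pt t a) y))); first exact: measurable_ln.
apply: (@measurableT_comp _ _ _ _ _ _ (@enorm R n) _
  (fun a => tsub (circle_pt t a) y)); first exact: measurable_enorm.
apply/measurable_fun_tnthP => i.
rewrite (_ : _ \o _ = fun a => (if i == i0 then t * cos a else if i == i1 then
    t * sin a else 0) - tnth y i); last first.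
  by apply/funext => a /=; rewrite !tnth_mktuple.
apply: measurable_funB => //; case: (i == i0).
  by apply: measurable_funM => //; apply: continuous_measurable_fun; exact: continuous_cos.
case: (i == i1) => //.
by apply: measurable_funM => //; apply: continuous_measurable_fun; exact: continuous_sin.
Qed.

(** The squared distance from [y] to the points of the circle has the form
    [p ^+ 2 + q ^+ 2 - circ b1 b2 a] treated in [circle_log_mean], where [p] is
    [focal_mean] and [q] is half the difference of the same two distances. *)
Lemma circle_pt_mean t y : 0 < t -> enorm y != t ->
  (\int[P]_a (ln (t + enorm y) - ln (enorm (tsub (circle_pt t a) y)))%:E =
   (ln (t + enorm y) - lnp t y)%:E)%E.
Proof.
move=> t0 yt.
have rho0 := enorm_ge0 y; have tau01 := plane_ratio01 y.
have ty0 : 0 < t + enorm y by rewrite ltr_pwDl.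
have d0 a : 0 < enorm (tsub (circle_pt t a) y) by exact: enorm_circle_ptB_gt0.
rewrite integral_uniform/=; last 2 first.
- exact: measurable_ln_circle_pt.
- move=> a; rewrite lee_fin subr_ge0 ler_ln ?posrE//.
  exact/enorm_circle_ptB_le/ltW.
rewrite subr0.
set A := t ^+ 2 + enorm y ^+ 2; set b := 2 * (t * enorm y * plane_ratio y).
have S0 : 0 <= A + b := focal_sum_ge0 (ltW t0) rho0 tau01.
have D0 : 0 <= A - b := focal_disc_ge0 (ltW t0) rho0 tau01.
pose p := focal_mean t (enorm y) (plane_ratio y).
pose q := (Num.sqrt (A + b) - Num.sqrt (A - b)) / 2.
have pE : p = (Num.sqrt (A + b) + Num.sqrt (A - b)) / 2 by [].
have SE := sqr_sqrtr S0; have DE := sqr_sqrtr D0.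
have b0 : 0 <= b.
  case/andP: tau01 => tau0 _.
  by apply: mulr_ge0 => //; apply: mulr_ge0 => //; apply: mulr_ge0 => //; exact: ltW.
have AE : p ^+ 2 + q ^+ 2 = A.
  have -> : p ^+ 2 + q ^+ 2 = (Num.sqrt (A + b) ^+ 2 + Num.sqrt (A - b) ^+ 2) / 2.
    by rewrite pE /q; field.
  by rewrite SE DE; lra.
have bE : 2 * (p * q) = b.
  have -> : 2 * (p * q) = (Num.sqrt (A + b) ^+ 2 - Num.sqrt (A - b) ^+ 2) / 2.
    by rewrite pE /q; field.
  by rewrite SE DE; lra.
have Ab : 0 < A - b.
  have h : 0 < (enorm y - t) ^+ 2.
    by rewrite lt_neqAle sqr_ge0 andbT eq_sym sqrf_eq0 subr_eq0.
  case/andP: tau01 => tau0 tau1.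
  have : t * enorm y * plane_ratio y <= t * enorm y.
    by rewrite ler_piMr// mulr_ge0// ltW.
  by rewrite /A /b; nra.
have sD : 0 < Num.sqrt (A - b) by rewrite sqrtr_gt0.
have SD : Num.sqrt (A - b) <= Num.sqrt (A + b) by rewrite ler_wsqrtr//; lra.
have qp : 0 <= q < p by rewrite pE /q; apply/andP; split; lra.
pose b1 := 2 * t * tnth y i0; pose b2 := 2 * t * tnth y i1.
have b12 : b1 ^+ 2 + b2 ^+ 2 = (2 * (p * q)) ^+ 2.
  rewrite bE /b -mulrA plane_ratioM /b1 /b2.
  have -> : (2 * (t * plane_norm y)) ^+ 2 = (2 * t) ^+ 2 * plane_norm y ^+ 2 by ring.
  by rewrite plane_norm_sqr; ring.
have pq0 : 0 < p + q by case/andP: qp => *; lra.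
have CE : 2 * ln (p + q) <= 2 * ln (t + enorm y).
  rewrite ler_pM2l// ler_ln ?posrE//.
  rewrite -(@ler_pXn2r _ 2)// ?nnegrE ?(ltW pq0) ?(ltW ty0)//.
  have -> : (p + q) ^+ 2 = A + b by rewrite -AE -bE; ring.
  have -> : (t + enorm y) ^+ 2 = A + 2 * (t * enorm y) by rewrite /A; ring.
  rewrite lerD2l /b ler_pM2l//; case/andP: tau01 => tau0 tau1.
  by rewrite ler_piMr// mulr_ge0// ltW.
have := circle_log_mean qp b12 CE; rewrite AE => I.
rewrite -integral_itv_bndo_bndc; last first.
  by apply: measurable_funTS; exact: measurable_ln_circle_pt.
transitivity (((2 * pi)^-1)%:E * ((2^-1)%:E * \int[lebesgue_measure]_(a in `[0%R, (2 * pi)%R[)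
    (2 * ln (t + enorm y) - ln (A - circ b1 b2 a))%:E))%E.
  congr (_ * _)%E; rewrite -ge0_integralZl//=; last 2 first.
  - apply: measurable_funTS; have := @measurable_circ_log R (2 * ln (t + enorm y)) A b1 b2 1.
    by under eq_fun do rewrite mul1r.
  - move=> a _; rewrite lee_fin subr_ge0 (le_trans _ CE)// -AE.
    by case/andP: (circ_ln_bounds a qp b12).
  apply: eq_integral => a _; rewrite -EFinM; congr EFin.
  rewrite /A /b1 /b2 -enorm_circle_ptB lnXn//.
  by rewrite -mulr_natl; field.
have pi0 : pi != 0 :> R by rewrite gt_eqF// pi_gt0.
rewrite I -!EFinM; congr EFin; rewrite /p.
by move: pi0; move: (pi : R) => c c0; field.
Qed.

End coordinate_plane.

Lemma measurable_focal_mean d (T : measurableType d) (R : realType)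
    (f g h : T -> R) : measurable_fun setT f -> measurable_fun setT g ->
  measurable_fun setT h ->
  measurable_fun setT (fun z => focal_mean (f z) (g z) (h z)).
Proof.
move=> mf mg mh; apply: measurable_funM => //.
have mA : measurable_fun setT (fun z => f z ^+ 2 + g z ^+ 2).
  by apply: measurable_funD; exact: measurable_funX.
have mB : measurable_fun setT (fun z => 2 * (f z * g z * h z)).
  by apply: measurable_funM => //; apply: measurable_funM => //; apply: measurable_funM.
apply: measurable_funD.
  apply: (@measurableT_comp _ _ _ _ _ _ (@Num.sqrt R) _
    (fun z => f z ^+ 2 + g z ^+ 2 + 2 * (f z * g z * h z))).
    exact: measurable_sqrtr.
  exact: measurable_funD.
apply: (@measurableT_comp _ _ _ _ _ _ (@Num.sqrt R) _
    (fun z => f z ^+ 2 + g z ^+ 2 - 2 * (f z * g z * h z))).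
  exact: measurable_sqrtr.
exact: measurable_funB.
Qed.

Lemma measurable_ln_focal_mean d (T : measurableType d) (R : realType)
    (f g h : T -> R) : measurable_fun setT f -> measurable_fun setT g ->
  measurable_fun setT h ->
  measurable_fun setT (fun z => ln (focal_mean (f z) (g z) (h z))).
Proof.
move=> mf mg mh; apply: (@measurableT_comp _ _ _ _ _ _ (@ln R) _
  (fun z => focal_mean (f z) (g z) (h z))); first exact: measurable_ln.
exact: measurable_focal_mean.
Qed.

Section mean_formula.
Context (R : realType) (n : nat) (i0 i1 : 'I_n).
Hypothesis i01 : i0 != i1.
Implicit Types (x y : n.-tuple R) (t : R).
Local Notation m := (@lebesgue_tuple R n).
Local Notation circle_pt := (@circle_pt R n i0 i1).
Local Notation plane_ratio := (plane_ratio i0 i1).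
Local Notation lnp t y := (ln (focal_mean t (enorm y) (plane_ratio y))).
Local Notation P := (uniform_prob (two_pi_gt0 R)).

Lemma ln_1Dsub_le t (s : R) : 0 < t -> 0 <= s -> `|ln (1 + s) - ln (t + s)| <= `|ln t|.
Proof.
move=> t0 s0; have s1 : 0 < 1 + s by rewrite ltr_pwDl.
have ts : 0 < t + s by rewrite ltr_pwDl.
have [t1|/ltW t1] := leP 1 t.
  rewrite distrC !ger0_norm ?ln_ge0// ?subr_ge0 ?ler_ln ?posrE ?lerD2r//.
  rewrite lerBlDr -lnM ?posrE// ler_ln ?posrE ?mulr_gt0// mulrDr mulr1 lerD2l.
  by rewrite ler_peMl.
rewrite ger0_norm ?subr_ge0 ?ler_ln ?posrE ?lerD2r// ler0_norm ?ln_le0//.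
rewrite lerBlDl -lerBlDr opprK -lnM ?posrE// ler_ln ?posrE ?mulr_gt0//.
by rewrite mulrDl mul1r mulrC lerD2l ler_piMl.
Qed.

Lemma ln_focal_mean_bounds t y : 0 < t ->
  0 <= ln (t + enorm y) - lnp t y <= ln 2.
Proof.
move=> t0; have rho0 := enorm_ge0 y; have tau01 := plane_ratio01 i01 y.
have ty0 : 0 < t + enorm y by rewrite ltr_pwDl.
have p0 := focal_mean_gt0 t0 rho0 tau01.
apply/andP; split.
  rewrite subr_ge0 ler_ln ?posrE//.
  have := focal_mean_lip (lexx 0) (ltW t0) rho0 tau01.
  by rewrite (focal_meanC 0) focal_mean0// subr0 addrC.
rewrite lerBlDl -lnM ?posrE// ler_ln ?posrE ?(mulr_gt0 p0)//.
have := focal_mean_ge (ltW t0) rho0 tau01.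
by rewrite ler_pdivrMr// mulrC.
Qed.

Lemma measurable_enorm_circle_ptB t :
  measurable_fun setT (fun z : R * n.-tuple R => enorm (tsub (circle_pt t z.1) z.2)).
Proof.
apply: (@measurableT_comp _ _ _ _ _ _ (@enorm R n) _
  (fun z : R * n.-tuple R => tsub (circle_pt t z.1) z.2)); first exact: measurable_enorm.
apply/measurable_fun_tnthP => i.
rewrite (_ : _ \o _ = fun z : R * n.-tuple R => (if i == i0 then t * cos z.1 else
    if i == i1 then t * sin z.1 else 0) - tnth z.2 i); last first.
  by apply/funext => a /=; rewrite !tnth_mktuple.
apply: measurable_funB => //; last first.
  apply: (@measurableT_comp _ _ _ _ _ _ (fun x : n.-tuple R => tnth x i) _
    (@snd R (n.-tuple R))); first exact: measurable_tnth.
  exact: measurable_snd.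
case: (i == i0).
  apply: measurable_funM => //; apply: (@measurableT_comp _ _ _ _ _ _ (@cos R)).
    by apply: continuous_measurable_fun; exact: continuous_cos.
  exact: measurable_fst.
case: (i == i1) => //.
apply: measurable_funM => //; apply: (@measurableT_comp _ _ _ _ _ _ (@sin R)).
  by apply: continuous_measurable_fun; exact: continuous_sin.
exact: measurable_fst.
Qed.

Lemma measurable_ln_1Denorm : measurable_fun setT (fun y : n.-tuple R => ln (1 + enorm y)).
Proof.
apply: (@measurableT_comp _ _ _ _ _ _ (@ln R) _ (fun y : n.-tuple R => 1 + enorm y)).
  exact: measurable_ln.
by apply: measurable_funD => //; exact: measurable_enorm.
Qed.

Variables (q : n.-tuple R -> R) (t : R).
Hypothesis t0 : 0 < t.
Hypothesis iq : m.-integrable setT (EFin \o q).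

Let mq : measurable_fun setT q.
Proof. by apply/measurable_EFinP; exact: measurable_int iq. Qed.

Let f (z : R * n.-tuple R) : \bar R :=
  ((ln (1 + enorm z.2) - ln (enorm (tsub (circle_pt t z.1) z.2))) * q z.2)%:E.

Let mf : measurable_fun setT f.
Proof.
apply/measurable_EFinP; apply: measurable_funM; last first.
  by apply: (@measurableT_comp _ _ _ _ _ _ q); [exact: mq|exact: measurable_snd].
apply: measurable_funB.
  apply: (@measurableT_comp _ _ _ _ _ _ (fun y : n.-tuple R => ln (1 + enorm y))).
    exact: measurable_ln_1Denorm.
  exact: measurable_snd.
apply: (@measurableT_comp _ _ _ _ _ _ (@ln R)); first exact: measurable_ln.
exact: measurable_enorm_circle_ptB.
Qed.

Let h y a : \bar R := (ln (t + enorm y) - ln (enorm (tsub (circle_pt t a) y)))%:E.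

Let mh y : measurable_fun setT (h y).
Proof. exact: measurable_ln_circle_pt. Qed.

Let h0 y a : enorm y != t -> (0 <= h y a)%E.
Proof.
move=> yt; rewrite lee_fin subr_ge0 ler_ln ?posrE ?enorm_circle_ptB_gt0//.
  exact/(enorm_circle_ptB_le i01)/ltW.
by rewrite ltr_pwDl// enorm_ge0.
Qed.

Let intP (c : \bar R) : (\int[P]_a c = c)%E.
Proof.
rewrite integral_cst// -[RHS]mule1; congr (_ * _)%E.
exact: (probability_setT P).
Qed.

Let f_abs y : enorm y != t ->
  (\int[P]_a `|f (a, y)| <= ((`|ln t| + ln 2) * `|q y|)%:E)%E.
Proof.
move=> yt; pose c := ln (1 + enorm y) - ln (t + enorm y).
apply: (@le_trans _ _ (\int[P]_a ((`|q y|)%:E * ((`|c|)%:E + h y a))))%E.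
  apply: ge0_le_integral => //.
  - by apply: measurableT_comp => //; exact: measurable_fun_pair1 mf.
  - by apply: emeasurable_funM => //; apply: emeasurable_funD => //; exact: mh.
  move=> a _; rewrite /f /h /= -EFinD -EFinM lee_fin normrM mulrC ler_wpM2l//.
  have -> : ln (1 + enorm y) - ln (enorm (tsub (circle_pt t a) y)) =
    c + (ln (t + enorm y) - ln (enorm (tsub (circle_pt t a) y))) by rewrite /c; ring.
  apply: le_trans (ler_normD _ _) _; rewrite lerD2l ger0_norm//.
  by have := h0 a yt; rewrite lee_fin.
rewrite ge0_integralZl//; last 2 first.
- by apply: emeasurable_funD => //; exact: mh.
- by move=> a _; apply: adde_ge0; [rewrite lee_fin|exact: h0].
rewrite ge0_integralD//; last 2 first.
- by move=> a _; exact: h0.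
- exact: mh.
rewrite intP circle_pt_mean// -EFinD -EFinM lee_fin mulrC.
rewrite ler_wpM2r// lerD//; first exact: ln_1Dsub_le (enorm_ge0 y).
by case/andP: (ln_focal_mean_bounds y t0).
Qed.

Let f_int y : enorm y != t ->
  (\int[P]_a f (a, y) = ((ln (1 + enorm y) - lnp t y) * q y)%:E)%E.
Proof.
move=> yt; pose c := ln (1 + enorm y) - ln (t + enorm y).
have ih : P.-integrable setT (h y).
  apply/integrableP; split; first exact: mh.
  under eq_integral do rewrite gee0_abs ?h0//.
  by rewrite circle_pt_mean// ltry.
transitivity (\int[P]_a ((c * q y)%:E + (q y)%:E * h y a))%E.
  by apply: eq_integral => a _; rewrite /f /h /c -EFinM -EFinD; congr EFin => /=; ring.
rewrite integralD//; last 2 first.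
- by apply: finite_measure_integrable_cst.
- exact: integrableZl.
rewrite intP integralZl// circle_pt_mean// -EFinM -EFinD.
by congr EFin; rewrite /c; ring.
Qed.

Let sphere_ae (p : n.-tuple R -> Prop) :
  (forall y, enorm y != t -> p y) -> {ae m, forall y, p y}.
Proof. by apply: ae_enorm_neq; exact: leq_ltn_trans (ltn_ord i0). Qed.

(** The potential of [q] takes the value [V] all along the circle, so it can be
    averaged over it.  Fubini's theorem applies to an arbitrary integrable [q]
    because the circle mean of the absolute value of the kernel is at most
    [`|ln t| + ln 2], uniformly in [y], in spite of the singularity. *)
Lemma mean_formula (V : \bar R) :
  (forall a, (\int[m]_y (ln ((1 + enorm y) / enorm (tsub (circle_pt t a) y)) * q y)%:E
     = V)%E) ->
  m.-integrable setT (fun y => ((ln (1 + enorm y) - lnp t y) * q y)%:E) /\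
  (V = \int[m]_y ((ln (1 + enorm y) - lnp t y) * q y)%:E)%E.
Proof.
move=> VE.
have mlnp : measurable_fun setT (fun y : n.-tuple R => lnp t y).
  apply: measurable_ln_focal_mean => //; [exact: measurable_enorm|exact: measurable_plane_ratio].
split.
  apply: (@le_integrable _ _ _ _ _ measurableT _
    (fun y => (`|ln t| + ln 2)%:E * (q y)%:E)%E).
  - apply/measurable_EFinP; apply: measurable_funM => //.
    by apply: measurable_funB => //; exact: measurable_ln_1Denorm.
  - move=> y _; rewrite -EFinM !abse_EFin lee_fin !normrM ler_wpM2r//.
    rewrite [leRHS]ger0_norm ?addr_ge0// ?ln_ge0 ?ler1n//.
    have -> : ln (1 + enorm y) - lnp t y = (ln (1 + enorm y) - ln (t + enorm y)) +
      (ln (t + enorm y) - lnp t y) by ring.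
    have /andP[b1 b2] := ln_focal_mean_bounds y t0.
    apply: le_trans (ler_normD _ _) _; rewrite lerD//; last by rewrite ger0_norm.
    exact: ln_1Dsub_le (enorm_ge0 y).
  - exact: integrableZl.
have fi : (P \x m)%E.-integrable setT f.
  apply/integrable21ltyP => //.
  apply: (@le_lt_trans _ _ (\int[m]_y ((`|ln t| + ln 2) * `|q y|)%:E)%E).
    apply: ae_ge0_le_integral => //.
    - by move=> y _; exact: integral_ge0.
    - have maf : measurable_fun setT (abse \o f) by exact: measurableT_comp.
      exact: (@measurable_fun_fubini_tonelli_G _ _ (measurableTypeR R) _ _ P _ maf
        (fun=> abse_ge0 _)).
    - by move=> y _; rewrite lee_fin mulr_ge0// addr_ge0// ln_ge0// ler1n.
    - by apply/measurable_EFinP; apply: measurable_funM => //; exact: measurableT_comp.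
    - by apply: sphere_ae => y yt _; exact: f_abs.
  have := integrableZl measurableT (`|ln t| + ln 2) iq => /integrableP[_].
  apply: le_lt_trans; rewrite le_eqVlt; apply/orP; left; apply/eqP.
  apply: eq_integral => y _; rewrite -EFinM abse_EFin normrM.
  by rewrite [in RHS]ger0_norm// addr_ge0// ln_ge0// ler1n.
have := Fubini fi.
have -> : (\int[P]_a \int[m]_y f (a, y) = V)%E.
  rewrite (eq_integral (fun=> V)).
    by rewrite intP.
  move=> a _; rewrite -(VE a); apply: ae_eq_integral => //.
  - exact: measurable_fun_pair2 mf.
  - apply/measurable_EFinP; apply: measurable_funM => //.
    apply: (@measurableT_comp _ _ _ _ _ _ (@ln R) _
      (fun y => (1 + enorm y) / enorm (tsub (circle_pt t a) y))).
      exact: measurable_ln.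
    rewrite (_ : (fun _ => _) = fun y => (1 + enorm y) *
        (enorm (tsub (circle_pt t a) y) `^ (-1))); last first.
      by apply/funext => y; rewrite powR_inv1// enorm_ge0.
    apply: measurable_funM.
      by apply: measurable_funD => //; exact: measurable_enorm.
    apply: (@measurableT_comp _ _ _ _ _ _ (@powR R ^~ (-1)) _
      (fun y => enorm (tsub (circle_pt t a) y))); first exact: measurable_powR.
    exact: measurable_fun_pair2 (measurable_enorm_circle_ptB t).
  - apply: sphere_ae => y yt _; rewrite /f/= ln_div// ?posrE ?enorm_circle_ptB_gt0//.
    by rewrite ltr_pwDl// enorm_ge0.
move=> ->; apply: ae_eq_integral => //.
- exact: (measurable_fubini_G fi).
- apply/measurable_EFinP; apply: measurable_funM => //.
  by apply: measurable_funB => //; exact: measurable_ln_1Denorm.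
- by apply: sphere_ae => y yt _; exact: f_int.
Qed.

End mean_formula.

(** * Exchanging the radii of two points *)

Lemma mule_canl (R : realType) (c x y : \bar R) : c \is a fin_num -> (0 < c)%E ->
  (c * x = c * y)%E -> x = y.
Proof.
move=> cf c0 E; apply/eqP; rewrite eq_le.
by rewrite -(lee_pmul2l cf c0) -(lee_pmul2l cf c0 y) E lexx.
Qed.

Section radial_symmetry.
Context (R : realType) (n : nat) (i0 i1 : 'I_n).
Hypothesis i01 : i0 != i1.
Implicit Types (x y : n.-tuple R).
Local Notation m := (@lebesgue_tuple R n).
Local Notation plane_ratio := (plane_ratio i0 i1).
Local Open Scope ereal_scope.

(** Lebesgue measure does not correlate [plane_ratio] with the radius, so that
    the radii of two independent points may be exchanged. *)
Lemma ge0_integral_radial_sym (k : R * R * R -> \bar R) :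
  measurable_fun setT k -> (forall z, 0 <= k z) ->
  \int[m]_x \int[m]_y k (enorm x, enorm y, plane_ratio y) =
  \int[m]_x \int[m]_y k (enorm y, enorm x, plane_ratio y).
Proof.
move=> mk k0; have n0 : (0 < n)%N by exact: leq_ltn_trans (ltn_ord i0).
have /andP[c0 coo] := @lebesgue_tuple_eball1 R n n0.
have cf : m (@eball R n 1) \is a fin_num by rewrite ge0_fin_numE// ltW.
have [kappa kE] := ge0_integral_polar n0 (@measurable_plane_ratio R n i0 i1)
  (fun a x => @plane_ratio_dilation R n i0 i1 a x).
have me := @measurable_enorm R n.
have mp := @measurable_plane_ratio R n i0 i1.
pose k1 (z : n.-tuple R * n.-tuple R * n.-tuple R) :=
  k (enorm z.1.1, enorm z.1.2, plane_ratio z.2).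
have mk1 : measurable_fun setT k1.
  apply: (@measurableT_comp _ _ _ _ _ _ k _
    (fun z : n.-tuple R * n.-tuple R * n.-tuple R =>
      (enorm z.1.1, enorm z.1.2, plane_ratio z.2))) => //.
  apply: measurable_fun_pair; last by apply: measurableT_comp.
  apply: measurable_fun_pair.
    apply: (@measurableT_comp _ _ _ _ _ _ (@enorm R n) _
      (fun z : n.-tuple R * n.-tuple R * n.-tuple R => z.1.1)) => //.
    exact: measurableT_comp.
  apply: (@measurableT_comp _ _ _ _ _ _ (@enorm R n) _
      (fun z : n.-tuple R * n.-tuple R * n.-tuple R => z.1.2)) => //.
  exact: measurableT_comp.
pose G (z : n.-tuple R * n.-tuple R) := \int[kappa]_y k1 (z, y).
have mG : measurable_fun setT G 
  by exact: (@measurable_fun_fubini_tonelli_F _ _ _ _ _ kappa k1 mk1 (fun z => k0 _)).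
have G0 z : 0 <= G z by apply: integral_ge0 => y _; exact: k0.
have step1 x : m (@eball R n 1) * \int[m]_y k (enorm x, enorm y, plane_ratio y) =
    \int[m]_y G (x, y).
  apply: (kE (fun z => k (enorm x, z.1, z.2))) => //.
  apply: (@measurableT_comp _ _ _ _ _ _ k _
    (fun z : R * R => (enorm x, z.1, z.2))) => //.
  by apply: measurable_fun_pair => //; apply: measurable_fun_pair.
have step2 x : m (@eball R n 1) * \int[m]_y k (enorm y, enorm x, plane_ratio y) =
    \int[m]_y G (y, x).
  apply: (kE (fun z => k (z.1, enorm x, z.2))) => //.
  apply: (@measurableT_comp _ _ _ _ _ _ k _
    (fun z : R * R => (z.1, enorm x, z.2))) => //.
  by apply: measurable_fun_pair => //; apply: measurable_fun_pair.
pose ka (z : n.-tuple R * n.-tuple R) := k (enorm z.1, enorm z.2, plane_ratio z.2).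
pose kb (z : n.-tuple R * n.-tuple R) := k (enorm z.2, enorm z.1, plane_ratio z.2).
have m1 : measurable_fun setT (fun z : n.-tuple R * n.-tuple R => enorm z.1).
  exact: measurableT_comp.
have m2 : measurable_fun setT (fun z : n.-tuple R * n.-tuple R => enorm z.2).
  exact: measurableT_comp.
have m3 : measurable_fun setT (fun z : n.-tuple R * n.-tuple R => plane_ratio z.2).
  exact: measurableT_comp.
have mka : measurable_fun setT ka.
  apply: (@measurableT_comp _ _ _ _ _ _ k _ (fun z : n.-tuple R * n.-tuple R =>
    (enorm z.1, enorm z.2, plane_ratio z.2))) => //.
  by apply: measurable_fun_pair => //; apply: measurable_fun_pair.
have mkb : measurable_fun setT kb.
  apply: (@measurableT_comp _ _ _ _ _ _ k _ (fun z : n.-tuple R * n.-tuple R =>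
    (enorm z.2, enorm z.1, plane_ratio z.2))) => //.
  by apply: measurable_fun_pair => //; apply: measurable_fun_pair.
pose a x := \int[m]_y k (enorm x, enorm y, plane_ratio y).
pose b x := \int[m]_y k (enorm y, enorm x, plane_ratio y).
have ma : measurable_fun setT a.
  exact: (@measurable_fun_fubini_tonelli_F _ _ _ _ _ m ka mka (fun z => k0 _)).
have mb : measurable_fun setT b.
  exact: (@measurable_fun_fubini_tonelli_F _ _ _ _ _ m kb mkb (fun z => k0 _)).
have a0 x : 0 <= a x by apply: integral_ge0 => y _; exact: k0.
have b0 x : 0 <= b x by apply: integral_ge0 => y _; exact: k0.
rewrite -/a -/b.
have stepa x : m (@eball R n 1) * a x = \int[m]_y G (x, y) by exact: step1.
have stepb x : m (@eball R n 1) * b x = \int[m]_y G (y, x) by exact: step2.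
have E : m (@eball R n 1) * \int[m]_x a x = m (@eball R n 1) * \int[m]_x b x.
  have Za := ge0_integralZl m measurableT ma (fun x _ => a0 x) (ltW c0).
  have Zb := ge0_integralZl m measurableT mb (fun x _ => b0 x) (ltW c0).
  have Ea : \int[m]_x (m (@eball R n 1) * a x) = \int[m]_x \int[m]_y G (x, y).
    by apply: eq_integral => x _; exact: stepa.
  have Eb : \int[m]_x (m (@eball R n 1) * b x) = \int[m]_x \int[m]_y G (y, x).
    by apply: eq_integral => x _; exact: stepb.
  have F : \int[m]_x \int[m]_y G (x, y) = \int[m]_x \int[m]_y G (y, x).
    exact: (fubini_tonelli G mG G0).
  apply: etrans (esym Za) _; apply: etrans Ea _; apply: etrans F _.
  exact: etrans (esym Eb) Zb.
exact: (mule_canl cf c0 E).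
Qed.

End radial_symmetry.

Section weighted_kernel.
Context (R : realType) (n : nat) (i0 i1 : 'I_n).
Hypothesis i01 : i0 != i1.
Implicit Types (x y : n.-tuple R).
Local Notation m := (@lebesgue_tuple R n).
Local Notation plane_ratio := (plane_ratio i0 i1).

Lemma measurable_focal_kernel d (T : measurableType d) (h : R) (f g k : T -> R) :
  measurable_fun setT f -> measurable_fun setT g -> measurable_fun setT k ->
  measurable_fun setT (fun z => focal_kernel h (f z) (g z) (k z)).
Proof.
move=> mf mg mk; apply: measurable_funB; apply: measurable_ln_focal_mean => //.
  exact: measurable_funM.
exact: measurable_funM.
Qed.

Variables (W : R -> R) (L h : R).
Hypotheses (mW : measurable_fun setT W) (W0 : forall r, 0 <= W r).
Hypothesis WL : (\int[m]_x (W (enorm x))%:E = L%:E)%E.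
Hypothesis h0 : 0 <= h.

(** The symmetric part of the kernel is constant, so that its quadratic form at
    the weight [W] only depends on the total mass. *)
Lemma integral_focal_kernel :
  (\int[m]_x \int[m]_y (W (enorm x) * W (enorm y) *
     focal_kernel h (enorm x) (enorm y) (plane_ratio y))%:E = (h * L ^+ 2)%:E)%E.
Proof.
have n0 : (0 < n)%N by exact: leq_ltn_trans (ltn_ord i0).
have me := @measurable_enorm R n : measurable_fun setT (@enorm R n).
have mp := @measurable_plane_ratio R n i0 i1.
pose k (z : R * R * R) : \bar R :=
  (W z.1.1 * W z.1.2 * `|focal_kernel h z.1.1 z.1.2 z.2|)%:E.
have mk : measurable_fun setT k.
  have m11 : measurable_fun setT (fun z : R * R * R => z.1.1) by exact: measurableT_comp.
  have m12 : measurable_fun setT (fun z : R * R * R => z.1.2) by exact: measurableT_comp.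
  apply/measurable_EFinP; apply: measurable_funM.
    apply: measurable_funM.
      exact: (@measurableT_comp _ _ _ _ _ _ W _ (fun z : R * R * R => z.1.1)).
    exact: (@measurableT_comp _ _ _ _ _ _ W _ (fun z : R * R * R => z.1.2)).
  apply: (@measurableT_comp _ _ _ _ _ _ (@Num.norm _ R) _
    (fun z : R * R * R => focal_kernel h z.1.1 z.1.2 z.2)) => //.
  exact: measurable_focal_kernel.
have k0 z : (0 <= k z)%E by rewrite lee_fin !mulr_ge0.
pose ka x y := k (enorm x, enorm y, plane_ratio y).
pose kb x y := k (enorm y, enorm x, plane_ratio y).
have kaE x y : ka x y = (W (enorm x) * W (enorm y) *
     focal_kernel h (enorm x) (enorm y) (plane_ratio y))%:E.
  rewrite /ka /k /= ger0_norm// focal_kernel_ge0 ?enorm_ge0//.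
  exact: plane_ratio01.
have kab x y : enorm x != 0 -> enorm y != 0 ->
    (ka x y + kb x y = (2 * h * W (enorm x))%:E * (W (enorm y))%:E)%E.
  move=> x0 y0; rewrite /ka /kb /k /= -EFinD -EFinM; congr EFin.
  have {}x0 : 0 < enorm x by rewrite lt_neqAle eq_sym x0 enorm_ge0.
  have {}y0 : 0 < enorm y by rewrite lt_neqAle eq_sym y0 enorm_ge0.
  have t01 := plane_ratio01 i01 y.
  rewrite !ger0_norm; [|exact: focal_kernel_ge0 (ltW _) (ltW _) _..].
  by have := focal_kernel_sym h x0 y0 t01; nra.
have m1 : measurable_fun setT (fun z : n.-tuple R * n.-tuple R => enorm z.1).
  exact: measurableT_comp.
have m2 : measurable_fun setT (fun z : n.-tuple R * n.-tuple R => enorm z.2).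
  exact: measurableT_comp.
have m3 : measurable_fun setT (fun z : n.-tuple R * n.-tuple R => plane_ratio z.2).
  exact: measurableT_comp.
have mka : measurable_fun setT (fun z => ka z.1 z.2).
  apply: (@measurableT_comp _ _ _ _ _ _ k _ (fun z : n.-tuple R * n.-tuple R =>
    (enorm z.1, enorm z.2, plane_ratio z.2))) => //.
  by apply: measurable_fun_pair => //; apply: measurable_fun_pair.
have mkb : measurable_fun setT (fun z => kb z.1 z.2).
  apply: (@measurableT_comp _ _ _ _ _ _ k _ (fun z : n.-tuple R * n.-tuple R =>
    (enorm z.2, enorm z.1, plane_ratio z.2))) => //.
  by apply: measurable_fun_pair => //; apply: measurable_fun_pair.
have sym : (\int[m]_x \int[m]_y ka x y = \int[m]_x \int[m]_y kb x y)%E.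
  exact: ge0_integral_radial_sym.
have ka0 x y : (0 <= ka x y)%E by exact: k0.
have kb0 x y : (0 <= kb x y)%E by exact: k0.
have mWe : measurable_fun setT (fun x : n.-tuple R => (W (enorm x))%:E).
  by apply/measurable_EFinP; exact: measurableT_comp.
transitivity (\int[m]_x \int[m]_y ka x y)%E.
  by apply: eq_integral => x _; apply: eq_integral => y _; rewrite kaE.
clearbody ka kb.
have W0e x : setT x -> (0 <= (W (enorm x))%:E)%E by rewrite lee_fin.
have mFa : measurable_fun setT (fun x => \int[m]_y ka x y)%E.
  exact: (@measurable_fun_fubini_tonelli_F _ _ _ _ _ m _ mka (fun z => ka0 _ _)).
have mFb : measurable_fun setT (fun x => \int[m]_y kb x y)%E.
  exact: (@measurable_fun_fubini_tonelli_F _ _ _ _ _ m _ mkb (fun z => kb0 _ _)).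
have mka1 x : measurable_fun setT (ka x).
  exact: (measurable_fun_pair2 x mka).
have mkb1 x : measurable_fun setT (kb x).
  exact: (measurable_fun_pair2 x mkb).
have sum : (\int[m]_x \int[m]_y ka x y + \int[m]_x \int[m]_y kb x y =
    (2 * h * L ^+ 2)%:E)%E.
  rewrite -ge0_integralD//; last 2 first.
  - by move=> x _; exact: integral_ge0.
  - by move=> x _; exact: integral_ge0.
  transitivity (\int[m]_x ((2 * h * L)%:E * (W (enorm x))%:E))%E.
    apply: ae_eq_integral => //.
    - exact: emeasurable_funD.
    - exact: emeasurable_funM.
    - apply: (ae_enorm_neq (r := 0) n0) => x x0 _.
      rewrite -ge0_integralD//.
      transitivity (\int[m]_y ((2 * h * W (enorm x))%:E * (W (enorm y))%:E))%E.
        apply: ae_eq_integral => //.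
        - exact: emeasurable_funD.
        - exact: emeasurable_funM.
        - by apply: (ae_enorm_neq (r := 0) n0) => y y0 _; exact: kab.
      rewrite (ge0_integralZl m measurableT mWe W0e); last by rewrite lee_fin !mulr_ge0.
      by rewrite WL -!EFinM; congr EFin; ring.
  have L0 : 0 <= L by rewrite -lee_fin -WL; apply: integral_ge0 => x _; rewrite lee_fin.
  rewrite (ge0_integralZl m measurableT mWe W0e); last by rewrite lee_fin !mulr_ge0.
  by rewrite WL -EFinM; congr EFin; ring.
move: sum; rewrite -sym; set I := (\int[m]_x _)%E.
have : (0 <= I)%E by apply: integral_ge0 => x _; exact: integral_ge0.
case: I => [r| |]//= _; rewrite -EFinD => -[E]; congr EFin; lra.
Qed.

End weighted_kernel.

(** * The radial profile of a normal solution *)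

Section radial_normal_solution.
Context (R : realType) (n : nat) (i0 i1 : 'I_n).
Hypothesis i01 : i0 != i1.
Variables (alpha : R) (Q u : n.-tuple R -> R).
Hypotheses (hu : normal_solution alpha Q u) (hrad : radial u).
Implicit Types (x y : n.-tuple R).
Local Notation m := (@lebesgue_tuple R n).
Local Notation plane_ratio := (plane_ratio i0 i1).
Local Notation lnp t y := (ln (focal_mean t (enorm y) (plane_ratio y))).
Local Notation g := (gamma_ R n).

Lemma gamma_gt0 : 0 < g.
Proof.
rewrite /gamma_ mulr_gt0 ?divr_gt0 ?ltr0n ?fact_gt0//.
exact: sphere_area_gt0.
Qed.

Definition profile (r : R) : R := u (circle_pt i0 i1 r 0).

Lemma profileE x : u x = profile (enorm x).
Proof. by apply: hrad; rewrite enorm_circle_pt// enorm_ge0. Qed.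

Definition curvature_density y : R :=
  enorm y `^ (n%:R * alpha) * Q y * expR (n%:R * u y).

Local Notation q := curvature_density.

(** The left-hand side of the integral equation being finite, so is the
    potential. *)
Lemma profile_mean : exists c : R, forall t, 0 < t ->
  m.-integrable setT (fun y => ((ln (1 + enorm y) - lnp t y) * q y)%:E) /\
  ((g * (profile t - c))%:E =
   \int[m]_y ((ln (1 + enorm y) - lnp t y) * q y)%:E)%E.
Proof.
have [iq [c uc]] := hu; exists c => t t0; apply: mean_formula => // a.
have := uc (circle_pt i0 i1 t a).
rewrite profileE enorm_circle_pt ?ltW//; set I := (\int[m]_y _)%E => E.
have g0 := gamma_gt0.
change (I = (g * (profile t - c))%:E).
case: I E => [r| |] /=.
- rewrite -EFinM -EFinD => -[->]; congr EFin.
  by rewrite addrK mulrA divff ?mul1r// gt_eqF.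
- by rewrite gt0_muley ?lte_fin ?invr_gt0.
- by rewrite gt0_muleNy ?lte_fin ?invr_gt0.
Qed.

Lemma profile_difference r h : 0 < r ->
  m.-integrable setT (fun y =>
    (focal_kernel h r (enorm y) (plane_ratio y) * q y)%:E) /\
  ((g * (profile (expR (- h) * r) - profile (expR h * r)))%:E =
   \int[m]_y (focal_kernel h r (enorm y) (plane_ratio y) * q y)%:E)%E.
Proof.
move=> r0; have [c pc] := profile_mean.
have r1 : 0 < expR (- h) * r by rewrite mulr_gt0 ?expR_gt0.
have r2 : 0 < expR h * r by rewrite mulr_gt0 ?expR_gt0.
have [i1' E1] := pc _ r1; have [i2' E2] := pc _ r2.
have E : (fun y => (focal_kernel h r (enorm y) (plane_ratio y) * q y)%:E) =
  (fun y => (((ln (1 + enorm y) - lnp (expR (- h) * r) y) * q y)%:E -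
    ((ln (1 + enorm y) - lnp (expR h * r) y) * q y)%:E)%E).
  by apply/funext => y; rewrite -EFinB; congr EFin; rewrite /focal_kernel; ring.
rewrite E; split; first exact: integrableB.
rewrite integralB_EFin// -E1 -E2 -EFinB; congr EFin; ring.
Qed.

(** The total variation of the curvature measure divided by [gamma_]; it bounds
    the Lipschitz constant of the profile in the variable [ln r]. *)
Definition log_lipschitz : R := g^-1 * fine (\int[m]_y (`|q y|)%:E)%E.

Let iq : m.-integrable setT (EFin \o q).
Proof. by case: hu. Qed.

Let maq : measurable_fun setT (fun y => (`|q y|)%:E).
Proof.
apply/measurable_EFinP; apply: measurableT_comp => //.
by apply/measurable_EFinP; exact: measurable_int iq.
Qed.

Let iqf : (\int[m]_y (`|q y|)%:E)%E \is a fin_num.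
Proof.
have /integrableP[_ h] := iq.
by rewrite ge0_fin_numE// integral_ge0.
Qed.

Lemma log_lipschitz_ge0 : 0 <= log_lipschitz.
Proof.
apply: mulr_ge0; first by rewrite invr_ge0 (ltW gamma_gt0).
apply: fine_ge0.
by apply: integral_ge0 => y _; rewrite lee_fin.
Qed.

Lemma profile_difference_le r h : 0 < r -> 0 <= h ->
  `|profile (expR (- h) * r) - profile (expR h * r)| <= 2 * h * log_lipschitz.
Proof.
move=> r0 h0; have [iK E] := profile_difference h r0.
rewrite /log_lipschitz mulrCA ler_pdivlMl ?gamma_gt0//.
rewrite -[X in X * `|_|](gtr0_norm gamma_gt0) -normrM.
rewrite -lee_fin -abse_EFin E EFinM fineK//.
apply: le_trans (le_abse_integral _ _ _) _ => //.
  exact: measurable_int iK.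
rewrite -ge0_integralZl//; last first.
  by rewrite lee_fin mulr_ge0.
apply: ge0_le_integral => //.
- by apply: measurableT_comp => //; exact: measurable_int iK.
- exact: emeasurable_funM.
move=> y _; rewrite abse_EFin -EFinM lee_fin normrM ler_wpM2r//.
rewrite ger0_norm; first by apply: focal_kernel_le; rewrite ?enorm_ge0 ?plane_ratio01// ltW.
by apply: focal_kernel_ge0; rewrite ?enorm_ge0 ?plane_ratio01// ltW.
Qed.

(** The kernel of [profile_difference] is at most [2 * h]. *)
Lemma profile_lip a b :
  `|profile (expR a) - profile (expR b)| <= log_lipschitz * `|a - b|.
Proof.
wlog ab : a b / a <= b => [H|].
  have [|/ltW] := leP a b; first exact: H.
  by move=> /H; rewrite distrC (distrC b).
have h0 : 0 <= (b - a) / 2 by rewrite divr_ge0// subr_ge0.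
have := profile_difference_le (expR_gt0 ((a + b) / 2)) h0.
rewrite -!expRD.
have -> : - ((b - a) / 2) + (a + b) / 2 = a by field.
have -> : (b - a) / 2 + (a + b) / 2 = b by field.
have -> : 2 * ((b - a) / 2) = b - a by field.
by rewrite distrC => /le_trans; apply; rewrite mulrC (distrC a) ger0_norm ?subr_ge0.
Qed.

(** Away from the origin the profile is a continuous function of [ln `|r|]; the
    value at [0] is corrected by an indicator function. *)
Lemma measurable_profile : measurable_fun setT profile.
Proof.
pose V s := profile (expR s).
have mV : measurable_fun setT V.
  apply: continuous_measurable_fun => s.
  apply/cvgrPdist_le => e e0.
  have C0 : 0 < log_lipschitz + 1 by rewrite (le_lt_trans log_lipschitz_ge0)// ltrDl.
  have e1 : 0 < e / (log_lipschitz + 1) by exact: divr_gt0.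
  have /cvgrPdist_le /(_ _ e1) sz : (fun z : R => z) z @[z --> s] --> s by exact: cvg_id.
  near=> z.
  apply: le_trans (profile_lip s z) _.
  apply: (@le_trans _ _ ((log_lipschitz + 1) * `|s - z|)).
    by rewrite ler_wpM2r// lerDl.
  rewrite -ler_pdivlMl// mulrC.
  by near: z; exact: sz.
have -> : profile = fun r => V (ln `|r|) + (profile 0 - V (ln 0)) * \1_[set 0] r.
  apply/funext => r; rewrite indicE /V.
  have [->|r0] := eqVneq r 0.
    by rewrite normr0 mem_set//= mulr1 addrC subrK.
  rewrite memNset/=; last by move=> /eqP; rewrite (negbTE r0).
  rewrite mulr0 addr0 lnK ?posrE ?normr_gt0//.
  by rewrite /profile; apply: hrad; rewrite !enorm_circle_pt_norm// normr_id.
have mln : measurable_fun setT (fun r : R => ln `|r|).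
  by apply: (@measurableT_comp _ _ _ _ _ _ (@ln R) _ (@Num.norm _ R)) => //;
    exact: measurable_ln.
apply: measurable_funD; first exact: (measurableT_comp mV mln).
apply: measurable_funM => //; exact: measurable_indic.
Unshelve. all: by end_near. Qed.

End radial_normal_solution.

(** * Expansion of the mass under dilations *)

Lemma integrable_EFinD d (T : measurableType d) (R : realType)
    (mu : {measure set T -> \bar R}) (f g : T -> R) :
  mu.-integrable setT (EFin \o f) -> mu.-integrable setT (EFin \o g) ->
  mu.-integrable setT (EFin \o (fun x => f x + g x)).
Proof. by move=> fi gi; exact: (integrableD measurableT fi gi). Qed.

Lemma integrable_EFinZl d (T : measurableType d) (R : realType)
    (mu : {measure set T -> \bar R}) (k : R) (f : T -> R) :
  mu.-integrable setT (EFin \o f) ->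
  mu.-integrable setT (EFin \o (fun x => k * f x)).
Proof. by move=> fi; exact: (integrableZl measurableT k fi). Qed.

Section dilation_expansion.
Context (R : realType) (n : nat).
Variables (alpha C L : R) (p : R -> R).
Hypothesis n0 : (0 < n)%N.
Hypothesis mp : measurable_fun setT p.
Hypothesis C0 : 0 <= C.
Hypothesis plip : forall a b, `|p (expR a) - p (expR b)| <= C * `|a - b|.
Local Notation m := (@lebesgue_tuple R n).

Definition conformal_weight (r : R) : R := r `^ (n%:R * alpha) * expR (n%:R * p r).
Local Notation W := conformal_weight.

Lemma conformal_weight_ge0 r : 0 <= W r.
Proof. by rewrite mulr_ge0 ?powR_ge0 ?expR_ge0. Qed.

Lemma conformal_weight_gt0 r : 0 < r -> 0 < W r.
Proof. by move=> r0; rewrite mulr_gt0 ?powR_gt0 ?expR_gt0. Qed.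

Lemma measurable_conformal_weight : measurable_fun setT W.
Proof.
apply: measurable_funM; first exact: measurable_powR.
apply: (@measurableT_comp _ _ _ _ _ _ (@expR R) _ (fun r => n%:R * p r)).
  exact: measurable_expR.
exact: measurable_funM.
Qed.

Hypothesis WL : (\int[m]_x (W (enorm x))%:E = L%:E)%E.

Let increment h (x : n.-tuple R) : R := p (expR h * enorm x) - p (enorm x).

(** The logarithm of the ratio, Jacobian included, of the weight dilated by
    [expR h] to the weight itself; see [weight_z]. *)
Let z h x : R := n%:R * increment h x + n%:R * (1 + alpha) * h.

Let D : R := n%:R * (C + `|1 + alpha|).

Let D0 : 0 <= D.
Proof. by rewrite mulr_ge0// addr_ge0. Qed.

Let increment_le h x : `|increment h x| <= C * `|h|.
Proof.
rewrite /increment; have := enorm_ge0 x; rewrite le_eqVlt => /predU1P[<-|x0].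
  by rewrite mulr0 subrr normr0 mulr_ge0.
have := plip (h + ln (enorm x)) (ln (enorm x)).
by rewrite expRD lnK ?posrE// addrK.
Qed.

Let z_le h x : `|z h x| <= D * `|h|.
Proof.
apply: le_trans (ler_normD _ _) _.
have -> : D * `|h| = n%:R * (C * `|h|) + n%:R * `|1 + alpha| * `|h|.
  by rewrite /D; ring.
by rewrite !normrM normr_nat lerD// ler_wpM2l.
Qed.

Let weight_z h x : expR h ^+ n * W (enorm (tscale (expR h) x)) =
  W (enorm x) * expR (z h x).
Proof.
rewrite enorm_scale ?expR_ge0// /W powRM ?expR_ge0 ?enorm_ge0// -expRM.
have -> : expR (z h x) = expR h ^+ n * expR (h * (n%:R * alpha)) *
    (expR (n%:R * p (expR h * enorm x)) * expR (- (n%:R * p (enorm x)))).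
  rewrite -expRM_natl -!expRD; congr expR; rewrite /z /increment; ring.
have E : expR (n%:R * p (enorm x)) * expR (- (n%:R * p (enorm x))) = 1.
  by rewrite -expRD subrr expR0.
set e1 := expR (n%:R * p (enorm x)) in E *; set e2 := expR (- _) in E *.
set e3 := expR (n%:R * p _); set e4 := _ `^ _; set e5 := expR h ^+ n.
set e6 := expR (h * _).
have -> : e4 * e1 * (e5 * e6 * (e3 * e2)) = e4 * e5 * e6 * e3 * (e1 * e2) by ring.
by rewrite E mulr1; ring.
Qed.

Let mW : measurable_fun setT (fun x : n.-tuple R => W (enorm x)).
Proof.
apply: (@measurableT_comp _ _ _ _ _ _ W _ (@enorm R n)).
  exact: measurable_conformal_weight.
exact: measurable_enorm.
Qed.

Let mincrement h : measurable_fun setT (increment h).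
Proof.
apply: measurable_funB.
  apply: (@measurableT_comp _ _ _ _ _ _ p _ (fun x : n.-tuple R => expR h * enorm x)) => //.
  by apply: measurable_funM => //; exact: measurable_enorm.
apply: (@measurableT_comp _ _ _ _ _ _ p _ (@enorm R n)) => //.
exact: measurable_enorm.
Qed.

Let mz h : measurable_fun setT (z h).
Proof. by apply: measurable_funD => //; exact: measurable_funM. Qed.

Let iW : m.-integrable setT (EFin \o (fun x => W (enorm x))).
Proof.
apply/integrableP; split; first exact/measurable_EFinP.
rewrite (eq_integral (fun x => (W (enorm x))%:E)) ?WL ?ltry//.
by move=> x _; rewrite /= ger0_norm// conformal_weight_ge0.
Qed.

Let iWb (f : n.-tuple R -> R) M : measurable_fun setT f ->
  (forall x, `|f x| <= M) -> m.-integrable setT (EFin \o (fun x => W (enorm x) * f x)).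
Proof.
move=> mf fM; apply: (@le_integrable _ _ _ _ _ measurableT _
  (fun x => M%:E * (W (enorm x))%:E)%E); last exact: integrableZl.
  by apply/measurable_EFinP; exact: measurable_funM.
move=> x _; rewrite -EFinM /= lee_fin !normrM mulrC ler_wpM2r//.
exact: le_trans (fM x) (ler_norm _).
Qed.

Lemma integrable_weight_increment h : m.-integrable setT
  (EFin \o (fun x => W (enorm x) * (p (expR h * enorm x) - p (enorm x)))).
Proof. exact: (iWb (mincrement h) (increment_le h)). Qed.

(** The upper bound follows from [expR (- (s / 2)) >= 1 - s / 2]. *)
Lemma expR_quadratic (s : R) : `|s| <= 1 / 4 -> 0 <= expR s - 1 - s <= s ^+ 2.
Proof.
rewrite ler_norml => /andP[s1 s2]; apply/andP; split.
  by have := expR_ge1Dx s; lra.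
have e0 := expR_gt0 (s / 2); have eN : 1 - s / 2 <= expR (- (s / 2)).
  by have := expR_ge1Dx (- (s / 2)); lra.
have E : expR (s / 2) * expR (- (s / 2)) = 1 by rewrite -expRD subrr expR0.
have -> : expR s = expR (s / 2) ^+ 2 by rewrite expr2 -expRD; congr expR; field.
have h1 : expR (s / 2) * (1 - s / 2) <= 1 by rewrite -[leRHS]E ler_pM2l.
have h2 : (expR (s / 2) * (1 - s / 2)) ^+ 2 <= 1.
  by rewrite expr_le1// mulr_ge0 ?(ltW e0)//; lra.
have h3 : 1 <= (1 - s / 2) ^+ 2 * (1 + s + s ^+ 2).
  have -> : (1 - s / 2) ^+ 2 * (1 + s + s ^+ 2) =
    1 + s ^+ 2 / 4 * (1 - 3 * s + s ^+ 2) by field.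
  rewrite lerDl mulr_ge0 ?divr_ge0 ?sqr_ge0//.
  by have := sqr_ge0 s; lra.
suff : expR (s / 2) ^+ 2 <= 1 + s + s ^+ 2 by lra.
have c0 : 0 < (1 - s / 2) ^+ 2 by rewrite exprn_gt0//; lra.
rewrite -(ler_pM2l c0); apply: le_trans h3.
by rewrite mulrC -exprMn.
Qed.

Let lin (a b c : R) : a = a + b + c -> b = - c.
Proof. by lra. Qed.

(** The mass of the dilated weight [W * expR (z h _)] does not depend on [h].
    Expanding the exponential, the integral of [W * z h _] is therefore of the
    second order in [h], which is the claim up to the factor [n]. *)
Lemma weight_increment_expansion h : D * `|h| <= 1 / 4 ->
  `|\int[m]_x (W (enorm x) * (p (expR h * enorm x) - p (enorm x))) +
    (1 + alpha) * h * L| <= D ^+ 2 * L * h ^+ 2.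
Proof.
move=> Dh.
have nR : 0 < n%:R :> R by rewrite ltr0n.
have n1 : 1 <= n%:R :> R by rewrite ler1n.
pose e x := expR (z h x) - 1 - z h x.
have zh x : `|z h x| <= 1 / 4 by exact: le_trans (z_le h x) Dh.
have eB x : 0 <= e x <= D ^+ 2 * h ^+ 2.
  have /andP[e1 e2] := expR_quadratic (zh x); rewrite /e e1/=.
  apply: le_trans e2 _.
  rewrite -exprMn -[leLHS]real_normK ?num_real// -[leRHS]real_normK ?num_real//.
  by rewrite ler_pXn2r// ?nnegrE// normrM (ger0_norm D0).
have me : measurable_fun setT e.
  apply: measurable_funB => //; apply: measurable_funB => //.
  by apply: (@measurableT_comp _ _ _ _ _ _ (@expR R) _ (z h)) => //; exact: measurable_expR.
have ie : m.-integrable setT (EFin \o (fun x => W (enorm x) * e x)).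
  apply: (iWb (M := D ^+ 2 * h ^+ 2)) => // x; have /andP[e0 e1] := eB x.
  by rewrite ger0_norm.
have iz : m.-integrable setT (EFin \o (fun x => W (enorm x) * z h x)).
  by apply: (iWb (M := 1 / 4)).
have iinc := integrable_weight_increment h.
have IW : \int[m]_x W (enorm x) = L by rewrite /Rintegral WL.
have L0 : 0 <= L.
  by rewrite -IW; apply: Rintegral_ge0 => x _; exact: conformal_weight_ge0.
have Iexp : \int[m]_x (W (enorm x) * expR (z h x)) = L.
  rewrite /Rintegral.
  rewrite (eq_integral (fun x => (expR h ^+ n)%:E * (W (enorm (tscale (expR h) x)))%:E)%E); last first.
    by move=> x _; rewrite -EFinM weight_z.
  rewrite (ge0_integralZl m measurableT); last first.
  - by rewrite lee_fin exprn_ge0// expR_ge0.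
  - by move=> x _; rewrite lee_fin conformal_weight_ge0.
  - apply/measurable_EFinP.
    apply: (@measurableT_comp _ _ _ _ _ _ (fun x : n.-tuple R => W (enorm x)) _
      (tscale (expR h))) => //.
    exact: measurable_tscale.
  rewrite (@ge0_integral_dilation R n (expR h) (fun x => (W (enorm x))%:E))//.
  - exact: expR_gt0.
  - exact/measurable_EFinP.
  - by move=> x; rewrite lee_fin conformal_weight_ge0.
have split : L = L + \int[m]_x (W (enorm x) * z h x) + \int[m]_x (W (enorm x) * e x).
  rewrite -[LHS]Iexp -{1}IW -RintegralD// -RintegralD//.
    by apply: eq_Rintegral => x _; rewrite /e; ring.
  exact: integrable_EFinD.
have Iz : \int[m]_x (W (enorm x) * z h x) = n%:R *
    (\int[m]_x (W (enorm x) * increment h x) + (1 + alpha) * h * L).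
  rewrite -IW -RintegralZl// -RintegralD//.
    rewrite -RintegralZl//.
      by apply: eq_Rintegral => x _; rewrite /z; ring.
    by apply: integrable_EFinD => //; exact: integrable_EFinZl.
  exact: integrable_EFinZl.
have Ie0 : 0 <= \int[m]_x (W (enorm x) * e x).
  apply: Rintegral_ge0 => x _; rewrite mulr_ge0 ?conformal_weight_ge0//.
  by case/andP: (eB x).
have Ie1 : \int[m]_x (W (enorm x) * e x) <= D ^+ 2 * L * h ^+ 2.
  rewrite mulrAC -IW -RintegralZl//; apply: le_Rintegral => //.
    exact: integrable_EFinZl.
  move=> x _; rewrite mulrC ler_wpM2r ?conformal_weight_ge0//.
  by case/andP: (eB x).
rewrite Iz in split; rewrite -/(increment h _).
set X := (X in `|X|).
have XE : n%:R * X = - \int[m]_x (W (enorm x) * e x) by exact: lin split.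
have X0 : X <= 0 by rewrite -(pmulr_rle0 _ nR) XE oppr_le0.
rewrite ler0_norm//; apply: le_trans Ie1.
have -> : \int[m]_x (W (enorm x) * e x) = n%:R * (- X) by rewrite mulrN XE opprK.
by rewrite ler_peMl// oppr_ge0.
Qed.

End dilation_expansion.

(** * The Pohozaev inequality *)

Section pohozaev.
Context (R : realType) (n : nat) (i0 i1 : 'I_n).
Hypothesis i01 : i0 != i1.
Variables (alpha L : R) (Q u : n.-tuple R -> R).
Hypotheses (hu : normal_solution alpha Q u) (hrad : radial u).
Implicit Types (x y : n.-tuple R).
Local Notation m := (@lebesgue_tuple R n).
Local Notation plane_ratio := (plane_ratio i0 i1).
Local Notation g := (gamma_ R n).
Hypothesis hQ1 : {ae m, forall x, Q x <= 1}.

Let p := profile i0 i1 u.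
Let W := conformal_weight n alpha p.
Let w x := W (enorm x).
Let q := curvature_density alpha Q u.

Lemma conformal_weightE x : w x = enorm x `^ (n%:R * alpha) * expR (n%:R * u x).
Proof. by rewrite /w /W /conformal_weight (profileE i01 hrad). Qed.

Let qE x : q x = Q x * w x.
Proof. by rewrite conformal_weightE /q /curvature_density; ring. Qed.

Hypothesis WL : (\int[m]_x (w x)%:E = L%:E)%E.

Let mp : measurable_fun setT p.
Proof. exact: measurable_profile hu hrad. Qed.

Let w0 x : 0 <= w x.
Proof. exact: conformal_weight_ge0. Qed.

Let wgt0 x : 0 < enorm x -> 0 < w x.
Proof. by move=> x0; exact: conformal_weight_gt0. Qed.

Let mw : measurable_fun setT w.
Proof.
apply: (@measurableT_comp _ _ _ _ _ _ W _ (@enorm R n)).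
  exact: measurable_conformal_weight.
exact: measurable_enorm.
Qed.

Let iw : m.-integrable setT (EFin \o w).
Proof.
apply/integrableP; split; first exact/measurable_EFinP.
rewrite (eq_integral (fun x => (w x)%:E)) ?WL ?ltry//.
by move=> x _; rewrite /= ger0_norm.
Qed.

Let iq : m.-integrable setT (EFin \o q).
Proof. by case: hu. Qed.

Let mq : measurable_fun setT q.
Proof. by apply/measurable_EFinP; exact: measurable_int iq. Qed.

(** Almost everywhere this is [(1 - Q) * w]; the maximum makes it nonnegative on
    the exceptional null set as well. *)
Let defect y : R := Num.max 0 (w y - q y).

Let defect0 y : 0 <= defect y.
Proof. by rewrite le_max lexx. Qed.

Let mdefect : measurable_fun setT defect.
Proof. by apply: measurable_maxr => //; exact: measurable_funB. Qed.

Let idefect : m.-integrable setT (EFin \o defect).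
Proof.
apply: (@le_integrable _ _ _ _ _ measurableT _ (fun x => (w x)%:E - (q x)%:E)%E).
- exact/measurable_EFinP.
- move=> x _; rewrite -EFinB /= lee_fin ger0_norm// /defect ge_max normr_ge0/=.
  exact: ler_norm.
- exact: (integrableB measurableT iw iq).
Qed.

Let defectE : {ae m, forall y, defect y = w y - q y}.
Proof.
apply: filterS hQ1 => y Qy; rewrite /defect max_r// subr_ge0 qE.
by rewrite -[leRHS]mul1r ler_wpM2r.
Qed.

Let K h x y := focal_kernel h (enorm x) (enorm y) (plane_ratio y).

Let K0 h x y : 0 <= h -> 0 <= K h x y.
Proof. by move=> h0; rewrite focal_kernel_ge0 ?enorm_ge0// plane_ratio01. Qed.

Let Kle h x y : 0 <= h -> K h x y <= 2 * h.
Proof. by move=> h0; rewrite focal_kernel_le ?enorm_ge0// plane_ratio01. Qed.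

Let mK h : measurable_fun setT (fun z : n.-tuple R * n.-tuple R => K h z.1 z.2).
Proof.
have me := @measurable_enorm R n : measurable_fun setT (@enorm R n).
have mr := @measurable_plane_ratio R n i0 i1.
apply: measurable_focal_kernel.
- exact: measurableT_comp.
- exact: measurableT_comp.
- exact: measurableT_comp.
Qed.

Let mK1 h x : measurable_fun setT (K h x).
Proof. exact: (measurable_fun_pair2 x (mK h)). Qed.

Let iK h x (f : n.-tuple R -> R) : 0 <= h -> m.-integrable setT (EFin \o f) ->
  m.-integrable setT (EFin \o (fun y => K h x y * f y)).
Proof.
move=> h0 fi; apply: (@le_integrable _ _ _ _ _ measurableT _
  (fun y => (2 * h)%:E * (f y)%:E)%E); last exact: integrableZl.
  apply/measurable_EFinP; apply: measurable_funM => //.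
  by apply/measurable_EFinP; exact: measurable_int fi.
move=> y _; rewrite -EFinM /= lee_fin [leLHS]normrM [leRHS]normrM ler_wpM2r//.
rewrite ger0_norm ?K0//; by apply: le_trans (ler_norm _); exact: Kle.
Qed.

Let Delta h x := p (expR (- h) * enorm x) - p (expR h * enorm x).

(** With [Q] written as [1 - (1 - Q)], both integrands are nonnegative. *)
Let equation h x : 0 <= h ->
  ((g * Delta h x)%:E + \int[m]_y (K h x y * defect y)%:E =
   \int[m]_y (K h x y * w y)%:E)%E.
Proof.
move=> h0; have E1 : (g * Delta h x)%:E = (\int[m]_y (K h x y * q y)%:E)%E.
  have := enorm_ge0 x; rewrite le_eqVlt => /predU1P[x0|x0].
    rewrite /Delta -x0 !mulr0 subrr mulr0.
    under eq_integral do rewrite /K -x0 /focal_kernel !mulr0 subrr mul0r.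
    by rewrite integral0.
  by have [_] := profile_difference i01 hu hrad h x0.
have iKq := iK x h0 iq; have iKd := iK x h0 idefect.
have iKw := iK x h0 iw.
rewrite E1 -(integralD_EFin measurableT iKq iKd).
apply: (@ae_eq_integral _ _ _ m setT _ _ measurableT).
- by apply: emeasurable_funD; [exact: measurable_int iKq|exact: measurable_int iKd].
- exact: measurable_int iKw.
apply: filterS defectE => y dE _; rewrite /= -EFinD -mulrDr dE.
by rewrite addrC subrK.
Qed.

(** The part of the defect at distance at most [enorm x / 4] from the origin,
    on which [focal_kernel_far] bounds the kernel from below. *)
Let near_part x y : R := w x * (((4 * enorm y <= enorm x)%R : bool)%:R * defect y).

(** Otherwise the balls of radii [r] and [2 * r] would have the same volume. *)
Lemma ext_not_negligible r : 0 < r -> ~ m.-negligible [set x | r <= enorm x].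
Proof.
move=> r0; have n0 : (0 < n)%N by exact: leq_ltn_trans (ltn_ord i0).
have /andP[c0 coo] := @lebesgue_tuple_eball1 R n n0.
have mE : measurable [set x : n.-tuple R | r <= enorm x].
  rewrite (_ : [set x | _] = ~` @eball R n r); last first.
    by apply/seteqP; split => x; rewrite /eball /=; [rewrite leNgt => /negP|move/negP; rewrite -leNgt].
  by apply: measurableC; exact: measurable_eball.
move=> /(negligibleP _ mE) N0.
have r2 : 0 < 2 * r by rewrite mulr_gt0.
have : (m (@eball R n (2 * r)) <= m (@eball R n r `|` [set x | (r <= enorm x)%R]))%E.
  apply: le_measure; rewrite ?inE//.
  - exact: measurable_eball.
  - by apply: measurableU => //; exact: measurable_eball.
  - by move=> x _ /=; rewrite /eball /=; have [|] := ltP (enorm x) r; [left|right].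
move=> /le_trans/(_ (measureU2 _ (@measurable_eball R n r) mE)).
change (m (@eball R n (2 * r)) <= m (@eball R n r) + m [set x | (r <= enorm x)%R] -> False)%E.
rewrite N0 adde0 (@lebesgue_tuple_eball R n _ r2) (@lebesgue_tuple_eball R n _ r0).
have cf : m (@eball R n 1) \is a fin_num by rewrite ge0_fin_numE// ltW.
rewrite -(fineK cf) -!EFinM lee_fin ler_pM2r ?fine_gt0 ?c0//.
rewrite exprMn ger_pMl ?exprn_gt0//.
by rewrite leNgt exprn_egt1// ?ltr1n// -lt0n n0.
Qed.

Lemma mass_gt0 : 0 < L.
Proof.
have L0 : 0 <= L by rewrite -lee_fin -WL; apply: integral_ge0 => x _; rewrite lee_fin.
rewrite lt_neqAle L0 andbT; apply/eqP => LE.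
apply: (@ext_not_negligible 1) => //.
have : (\int[m]_x `|(w x)%:E| = 0)%E.
  by rewrite (eq_integral (fun x => (w x)%:E)) ?WL -?LE// => x _; rewrite gee0_abs// lee_fin.
move/ae_eq_integral_abs => /(_ measurableT); case; first exact/measurable_EFinP.
move=> N [mN N0 sN]; exists N; split => // x /= x1; apply: sN => /= h.
have := h I => /eqP; rewrite eqe gt_eqF// /w conformal_weight_gt0//.
exact: lt_le_trans x1.
Qed.

Let J : \bar R := (\int[m]_x \int[m]_y (near_part x y)%:E)%E.

Let near0 x y : 0 <= near_part x y.
Proof. by rewrite mulr_ge0// mulr_ge0. Qed.

Let mnear : measurable_fun setT (fun z : n.-tuple R * n.-tuple R => near_part z.1 z.2).
Proof.
have me := @measurable_enorm R n : measurable_fun setT (@enorm R n).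
have m1 : measurable_fun setT (fun z : n.-tuple R * n.-tuple R => enorm z.1).
  exact: measurableT_comp.
have m2 : measurable_fun setT (fun z : n.-tuple R * n.-tuple R => enorm z.2).
  exact: measurableT_comp.
apply: measurable_funM.
  exact: (@measurableT_comp _ _ _ _ _ _ w _ (@fst (n.-tuple R) (n.-tuple R))).
apply: measurable_funM; last first.
  exact: (@measurableT_comp _ _ _ _ _ _ defect _ (@snd (n.-tuple R) (n.-tuple R))).
pose A := [set z : n.-tuple R * n.-tuple R | 4 * enorm z.2 <= enorm z.1].
have mA : measurable A.
  rewrite (_ : A = (fun z => enorm z.1 - 4 * enorm z.2) @^-1` `[0, +oo[); last first.
    by apply/seteqP; split => z; rewrite /A /= in_itv/= andbT subr_ge0.
  rewrite -[X in measurable X]setTI.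
  have mf : measurable_fun setT (fun z : n.-tuple R * n.-tuple R => enorm z.1 - 4 * enorm z.2).
    by apply: measurable_funB => //; exact: measurable_funM.
  exact: mf.
rewrite (_ : (fun _ => _) = (\1_A : _ -> R)); first exact: measurable_indic.
apply/funext => z; rewrite indicE; congr (_%:R); congr nat_of_bool.
by apply/idP/idP; rewrite inE.
Qed.

(** For a fixed nonzero [y] with [Q y < 1], the integrand of [J] is positive at every
    [x] with [4 * enorm y <= enorm x], and these form a set of positive
    measure. *)
Let J_eq0 : J = 0%E -> {ae m, forall y, Q y = 1}.
Proof.
have n0 : (0 < n)%N by exact: leq_ltn_trans (ltn_ord i0).
pose f (z : n.-tuple R * n.-tuple R) : \bar R := (near_part z.1 z.2)%:E.
have mf : measurable_fun setT f by exact/measurable_EFinP.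
have f0 z : (0 <= f z)%E by rewrite lee_fin.
pose F y : \bar R := (\int[m]_x f (x, y))%E.
have mF : measurable_fun setT F.
  exact: (@measurable_fun_fubini_tonelli_G _ _ _ _ _ m f mf f0).
have F0 y : (0 <= F y)%E by exact: integral_ge0.
have JF : J = (\int[m]_y F y)%E by exact: (fubini_tonelli f mf f0).
rewrite JF => F00.
have : ae_eq m setT F (cst 0%E).
  apply/(ae_eq_integral_abs _ measurableT mF); rewrite -[RHS]F00.
  by apply: eq_integral => y _; rewrite gee0_abs.
move=> aeF; have aey : {ae m, forall y : n.-tuple R, enorm y != 0}.
  exact: (ae_enorm_neq (r := 0) n0).
apply: filterS3 aeF hQ1 aey => y Fy Qy y0.
have {}y0 : 0 < enorm y by rewrite lt_neqAle eq_sym y0 enorm_ge0.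
apply/eqP; rewrite eq_le Qy/= leNgt; apply/negP => Q1.
have d0 : 0 < defect y.
  rewrite /defect lt_max; apply/orP; right; rewrite qE subr_gt0 -[ltRHS]mul1r.
  by rewrite (ltr_pM2r (wgt0 y0)).
have r0 : 0 < 4 * enorm y by rewrite mulr_gt0.
apply: (ext_not_negligible r0).
have mfy : measurable_fun setT (fun x => f (x, y)) by exact: (measurable_fun_pair1 y mf).
have : (\int[m]_x `|f (x, y)| = 0)%E.
  rewrite -[RHS](Fy Logic.I); apply: eq_integral => x _; rewrite gee0_abs//.
move/(ae_eq_integral_abs _ measurableT mfy) => [N [mN N0 sN]].
exists N; split; [exact: mN|exact: N0|move=> x x1; apply: sN => h].
have /eqP := h Logic.I.
have -> : f (x, y) = (w x * (1 * defect y))%:E by rewrite /f /near_part /= (x1 : _ <= _).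
have wd : 0 < w x * defect y := mulr_gt0 (wgt0 (lt_le_trans r0 x1)) d0.
by rewrite mul1r eqe (gt_eqF wd).
Qed.

Let le_small (a b c h1 : R) : 0 <= c -> 0 < h1 ->
  (forall h, 0 < h <= h1 -> a <= b + c * h) -> a <= b.
Proof.
move=> c0 h10 H; apply/ler_addgt0Pr => e e0.
have c1 : 0 < c + 1 by rewrite ltr_wpDl.
pose h := Num.min h1 (e / (c + 1)).
have h0 : 0 < h <= h1 by rewrite /h lt_min h10 divr_gt0//= ge_min lexx.
apply: le_trans (H h h0) _; rewrite lerD2l.
have he : h <= e / (c + 1) by rewrite /h ge_min lexx orbT.
apply: le_trans (ler_wpM2l c0 he) _.
by rewrite mulrCA ger_pMr// ler_pdivrMr// mul1r lerDl.
Qed.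

Let D : R := n%:R * (log_lipschitz alpha Q u + `|1 + alpha|).

Let increment h := \int[m]_x (w x * (p (expR h * enorm x) - p (enorm x))).

Let increment_expansion h : D * `|h| <= 1 / 4 ->
  `|increment h + (1 + alpha) * h * L| <= D ^+ 2 * L * h ^+ 2.
Proof.
have n0 : (0 < n)%N by exact: leq_ltn_trans (ltn_ord i0).
exact: (weight_increment_expansion n0 mp (log_lipschitz_ge0 alpha Q u)
  (profile_lip i01 hu hrad) WL).
Qed.

Let iinc h : m.-integrable setT
  (EFin \o (fun x => w x * (p (expR h * enorm x) - p (enorm x)))).
Proof.
exact: (integrable_weight_increment mp (log_lipschitz_ge0 alpha Q u)
  (profile_lip i01 hu hrad) WL).
Qed.

Let I h := \int[m]_x (w x * (g * Delta h x)).

Let wDeltaE h x : w x * (g * Delta h x) =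
  g * (w x * (p (expR (- h) * enorm x) - p (enorm x))) +
  - g * (w x * (p (expR h * enorm x) - p (enorm x))).
Proof. by rewrite /Delta; ring. Qed.

Let iDelta h : m.-integrable setT (EFin \o (fun x => w x * (g * Delta h x))).
Proof.
rewrite (_ : (fun x => _) = (fun x =>
  g * (w x * (p (expR (- h) * enorm x) - p (enorm x))) +
  - g * (w x * (p (expR h * enorm x) - p (enorm x))))).
  by apply: integrable_EFinD; exact: integrable_EFinZl.
by apply/funext => x; exact: wDeltaE.
Qed.

Let IE h : I h = g * (increment (- h) - increment h).
Proof.
transitivity (\int[m]_x (
  g * (w x * (p (expR (- h) * enorm x) - p (enorm x))) +
  - g * (w x * (p (expR h * enorm x) - p (enorm x))))).
  by apply: eq_Rintegral => x _; exact: wDeltaE.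
have i1' := integrable_EFinZl g (iinc (- h)).
have i2' := integrable_EFinZl (- g) (iinc h).
rewrite (RintegralD measurableT i1' i2').
rewrite (RintegralZl g measurableT (iinc (- h))) (RintegralZl (- g) measurableT (iinc h)).
by rewrite mulNr -mulrBr.
Qed.

Let B h x : \bar R := (\int[m]_y (w x * (K h x y * defect y))%:E)%E.

Let mB' h : measurable_fun setT (fun z : n.-tuple R * n.-tuple R =>
  (w z.1 * (K h z.1 z.2 * defect z.2))%:E).
Proof.
apply/measurable_EFinP; apply: measurable_funM.
  exact: (@measurableT_comp _ _ _ _ _ _ w _ (@fst (n.-tuple R) (n.-tuple R))).
apply: measurable_funM => //.
exact: (@measurableT_comp _ _ _ _ _ _ defect _ (@snd (n.-tuple R) (n.-tuple R))).
Qed.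

Let B0' h x y : 0 <= h -> 0 <= w x * (K h x y * defect y).
Proof. by move=> h0; rewrite mulr_ge0// mulr_ge0// K0. Qed.

Let mB h : 0 <= h -> measurable_fun setT (B h).
Proof.
move=> h0; apply: (@measurable_fun_fubini_tonelli_F _ _ _ _ _ m _ (mB' h)).
by move=> z; rewrite lee_fin B0'.
Qed.

Let BE h x : 0 <= h -> B h x = ((w x)%:E * \int[m]_y (K h x y * defect y)%:E)%E.
Proof.
move=> h0; have mKd : measurable_fun setT (fun y => (K h x y * defect y)%:E).
  by apply/measurable_EFinP; apply: measurable_funM => //; exact: mK1.
have Kd0 y : setT y -> (0 <= (K h x y * defect y)%:E)%E.
  by move=> _; rewrite lee_fin mulr_ge0// K0.
have wx0 : (0 <= (w x)%:E)%E by rewrite lee_fin.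
by rewrite -(ge0_integralZl m measurableT mKd Kd0 wx0).
Qed.

Let iB h : 0 <= h -> m.-integrable setT (B h).
Proof.
move=> h0; pose d := fine (\int[m]_y (defect y)%:E)%E.
have dE : (\int[m]_y (defect y)%:E = d%:E)%E.
  by rewrite fineK//; exact: (integrable_fin_num measurableT idefect).
apply: (@le_integrable _ _ _ _ _ measurableT _
  (fun x => (2 * h * d)%:E * (w x)%:E)%E).
- exact: mB.
- move=> x _; rewrite gee0_abs; last first.
    by apply: integral_ge0 => y _; rewrite lee_fin B0'.
  apply: le_trans (lee_abs _); rewrite BE// muleC.
  rewrite (lee_wpmul2r (_ : (0 <= (w x)%:E)%E)) ?lee_fin//.
  rewrite EFinM -dE -(ge0_integralZl m measurableT); last first.
  + by rewrite lee_fin mulr_ge0.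
  + by move=> y _; rewrite lee_fin.
  + exact/measurable_EFinP.
  apply: ge0_le_integral => //.
  + by move=> y _; rewrite lee_fin mulr_ge0// K0.
  + by apply/measurable_EFinP; apply: measurable_funM => //; exact: mK1.
  + by apply: emeasurable_funM => //; exact/measurable_EFinP.
  + by move=> y _; rewrite -EFinM lee_fin ler_wpM2r// Kle.
- exact: integrableZl.
Qed.

Let balance h : 0 <= h -> ((I h)%:E + \int[m]_x B h x = (h * L ^+ 2)%:E)%E.
Proof.
move=> h0; have IhE : (I h)%:E = (\int[m]_x (w x * (g * Delta h x))%:E)%E.
  rewrite /I /Rintegral fineK//.
  exact: (integrable_fin_num measurableT (iDelta h)).
rewrite IhE -(integralD measurableT (iDelta h) (iB h0)).
rewrite -(integral_focal_kernel i01 (measurable_conformal_weight n alpha mp)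
  (@conformal_weight_ge0 R n alpha p) WL h0).
apply: eq_integral => x _.
have mKw : measurable_fun setT (fun y => (K h x y * w y)%:E).
  by apply/measurable_EFinP; apply: measurable_funM => //; exact: mK1.
have Kw0 y : setT y -> (0 <= (K h x y * w y)%:E)%E.
  by move=> _; rewrite lee_fin mulr_ge0// K0.
have wx0 : (0 <= (w x)%:E)%E by rewrite lee_fin.
transitivity ((w x)%:E * \int[m]_y (K h x y * w y)%:E)%E.
  rewrite -(equation x h0) (BE x h0).
  have ad : ((g * Delta h x)%:E +? \int[m]_y (K h x y * defect y)%:E)%E.
    exact: fin_num_adde_defr.
  by rewrite (muleDr _ ad).
rewrite -(ge0_integralZl m measurableT mKw Kw0 wx0).
apply: eq_integral => y _; rewrite -EFinM; congr EFin.
by rewrite (mulrC (K h x y)) mulrA.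
Qed.

Let J_le h : 0 < h <= 1 / 2 -> (h%:E * J <= \int[m]_x B h x)%E.
Proof.
move=> /andP[h0 h1]; have h0' := ltW h0.
have n0 : (0 < n)%N by exact: leq_ltn_trans (ltn_ord i0).
pose j x : \bar R := (\int[m]_y (near_part x y)%:E)%E.
have mn : measurable_fun setT (fun z : n.-tuple R * n.-tuple R => (near_part z.1 z.2)%:E).
  exact/measurable_EFinP.
have mj : measurable_fun setT j.
  by apply: (@measurable_fun_fubini_tonelli_F _ _ _ _ _ m _ mn) => z; rewrite lee_fin.
have j0 x : setT x -> (0 <= j x)%E.
  by move=> _; apply: integral_ge0 => y _; rewrite lee_fin.
have hh : (0 <= h%:E)%E by rewrite lee_fin.
rewrite -(ge0_integralZl m measurableT mj j0 hh).
apply: ae_ge0_le_integral.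
- exact: measurableT.
- by move=> x xT; rewrite mule_ge0// j0.
- exact: emeasurable_funM.
- by move=> x _; apply: integral_ge0 => y _; rewrite lee_fin B0'.
- exact: mB.
apply: (ae_enorm_neq (r := 0) n0) => x x0 _.
have {}x0 : 0 < enorm x by rewrite lt_neqAle eq_sym x0 enorm_ge0.
have mnx : measurable_fun setT (fun y => (near_part x y)%:E).
  exact: (measurable_fun_pair2 x mn).
have nx0 y : setT y -> (0 <= (near_part x y)%:E)%E by rewrite lee_fin.
rewrite -(ge0_integralZl m measurableT mnx nx0 hh).
apply: ge0_le_integral.
- exact: measurableT.
- by move=> y yT; rewrite mule_ge0// nx0.
- exact: emeasurable_funM.
- exact: (measurable_fun_pair2 x (mB' h)).
move=> y _; rewrite -EFinM lee_fin /near_part mulrCA ler_wpM2l//.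
rewrite mulrA ler_wpM2r//; have [near|_] := boolP (4 * enorm y <= enorm x).
  rewrite mulr1; apply: focal_kernel_far => //; rewrite ?enorm_ge0 ?plane_ratio01//.
  by rewrite h0' h1.
by rewrite mulr0 K0.
Qed.

(** Divide [balance] by [h] and let [h] tend to [0], using the expansion of
    [I h] to the second order. *)
Let pohozaev : exists j : R, [/\ J = j%:E, 0 <= j,
  j <= L ^+ 2 - 2 * g * (1 + alpha) * L &
  {ae m, forall y, Q y = 1} -> L ^+ 2 <= 2 * g * (1 + alpha) * L].
Proof.
have D0 : 0 <= D by rewrite mulr_ge0// addr_ge0// log_lipschitz_ge0.
have g0 := gamma_gt0 R n; have L0 := mass_gt0.
(* the first bound is required by [focal_kernel_far], the second one by
   [increment_expansion] *)
pose h1 := Num.min (1 / 2) (1 / 4 / (D + 1)) : R.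
have D1 : 0 < D + 1 by rewrite ltr_wpDl.
have h10 : 0 < h1 by rewrite lt_min !divr_gt0.
have h12 h : h <= h1 -> h <= 1 / 2 by rewrite le_min => /andP[].
have Dh h : 0 < h -> h <= h1 -> D * h <= 1 / 4.
  move=> h0; rewrite le_min => /andP[_]; rewrite (ler_pdivlMr _ _ D1) => hD.
  apply: le_trans hD.
  by rewrite mulrC ler_wpM2l ?lerDl// ltW.
pose c := 2 * g * (D ^+ 2 * L).
have c0 : 0 <= c.
  by apply: mulr_ge0; [apply: mulr_ge0 => //; exact: ltW|apply: mulr_ge0; [exact: sqr_ge0|exact: ltW]].
have Ibnd h : 0 < h <= h1 -> `|I h - 2 * g * (1 + alpha) * L * h| <= c * h * h.
  move=> /andP[h0 hh1]; have Dhh := Dh h h0 hh1.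
  have nh : `|h| = h by rewrite gtr0_norm.
  have e1 : `|increment h + (1 + alpha) * h * L| <= D ^+ 2 * L * h ^+ 2.
    by apply: increment_expansion; rewrite nh.
  have e2 : `|increment (- h) - (1 + alpha) * h * L| <= D ^+ 2 * L * h ^+ 2.
    rewrite -mulNr -mulrN -(sqrrN h); apply: increment_expansion.
    by rewrite normrN nh.
  move: e1 e2.
  rewrite IE; move: (increment h) (increment (- h)) => a b.
  rewrite !ler_norml => /andP[e1 e2] /andP[e3 e4].
  rewrite /c; set k := D ^+ 2 * L * h ^+ 2 in e1 e2 e3 e4.
  have -> : 2 * g * (D ^+ 2 * L) * h * h = g * (2 * k) by rewrite /k; ring.
  have -> : g * (b - a) - 2 * g * (1 + alpha) * L * h =
    g * (b - a - 2 * ((1 + alpha) * h * L)) by ring.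
  by rewrite -mulrN !ler_pM2l//; apply/andP; split; lra.
have J0 : (0 <= J)%E by apply: integral_ge0 => x _; apply: integral_ge0 => y _; rewrite lee_fin.
have Bge h : 0 < h <= h1 -> (h%:E * J <= (h * L ^+ 2 - I h)%:E)%E.
  move=> /andP[h0 hh1]; have := balance (ltW h0).
  have := J_le; move=> /(_ h); rewrite h0 h12// => /(_ isT).
  case: (\int[m]_x B h x)%E => [r| |]//.
  by move=> Jr; rewrite -EFinD => -[<-]; rewrite addrC addKr.
have Jf : J \is a fin_num.
  have hh : 0 < h1 <= h1 by rewrite h10 lexx.
  rewrite (ge0_fin_numE J0) ltey; apply/eqP => E.
  by have := Bge h1 hh; rewrite E gt0_muley ?lte_fin.
exists (fine J); split.
- by rewrite fineK.
- exact: fine_ge0.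
- apply: (le_small c0 h10) => h hh; have := Bge h hh; have := Ibnd h hh.
  rewrite -{1}(fineK Jf) -EFinM lee_fin; case/andP: hh => h0 _.
  rewrite ler_norml => /andP[b1 b2] b3.
  rewrite -(ler_pM2l h0); move: b1 b2 b3; move: (fine J) (I h) => a b.
  by nra.
- move=> Q1; apply: (le_small c0 h10) => h hh.
  have B0 : (\int[m]_x B h x = 0)%E.
    apply: integral0_eq => x _.
    rewrite /B -[RHS](integral0 m setT).
    apply: (@ae_eq_integral _ _ _ m setT _ _ measurableT).
    - exact: (measurable_fun_pair2 x (mB' h)).
    - exact: measurable_cst.
    apply: filterS2 defectE Q1 => y dy Qy _.
    by rewrite dy qE Qy mul1r subrr !mulr0.
  have := Ibnd h hh; have := balance; move=> /(_ h).
  case/andP: hh => h0 _; rewrite B0 adde0 => /(_ (ltW h0)) [->].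
  rewrite ler_norml => /andP[b1 b2].
  by rewrite -(ler_pM2l h0); nra.
Qed.

Lemma mass_ge : 2 * g * (1 + alpha) <= L.
Proof.
have [j [_ j0 jL _]] := pohozaev; have L0 := mass_gt0.
rewrite -(ler_pM2r L0) -expr2; lra.
Qed.

Lemma mass_eq : L = 2 * g * (1 + alpha) <-> {ae m, forall y, Q y = 1}.
Proof.
have [j [JE j0 jL Q1L]] := pohozaev; have L0 := mass_gt0; split => [LE|Q1].
  apply: J_eq0; rewrite JE; congr EFin; apply/eqP; rewrite eq_le j0 andbT.
  by rewrite {1}LE in jL; move: jL; rewrite -{1}LE expr2 {1}LE subrr.
apply/eqP; rewrite eq_le mass_ge andbT -(ler_pM2r L0) -expr2; exact: Q1L.
Qed.

End pohozaev.

(** * The lower bound on the mass *)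

Theorem theorem1p2 (R : realType) (n : nat) (alpha : R)
    (Q u : n.-tuple R -> R)
    (hn : (2 <= n)%N)
    (halpha : -1 < alpha)
    (hQ : Linfty_loc Q)
    (hu : normal_solution alpha Q u)
    (hrad : radial u)
    (hint : (\int[@lebesgue_tuple R n]_x
      (enorm x `^ (n%:R * alpha) * `|Q x| * expR (n%:R * u x))%:E < +oo)%E)
    (hQ1 : {ae @lebesgue_tuple R n, forall x, Q x <= 1}) :
  let Lambda : \bar R := (\int[@lebesgue_tuple R n]_x
    (enorm x `^ (n%:R * alpha) * expR (n%:R * u x))%:E)%E in
  ((Lambda1 R n * (1 + alpha))%:E <= Lambda)%E /\
  (Lambda = (Lambda1 R n * (1 + alpha))%:E <->
   {ae @lebesgue_tuple R n, forall x, Q x = 1}).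
Proof.
move=> Lambda.
have n0 : (0 < n)%N by exact: leq_trans hn.
pose i0 : 'I_n := Ordinal n0; pose i1 : 'I_n := Ordinal hn.
have i01 : i0 != i1 by [].
have Lambda_ge0 : (0 <= Lambda)%E.
  by apply: integral_ge0 => x _; rewrite lee_fin mulr_ge0 ?powR_ge0 ?expR_ge0.
pose W (x : n.-tuple R) := conformal_weight n alpha (profile i0 i1 u) (enorm x).
have WE x : W x = enorm x `^ (n%:R * alpha) * expR (n%:R * u x).
  exact: (conformal_weightE i01 alpha hrad).
have mW : measurable_fun setT W.
  have mp : measurable_fun setT (profile i0 i1 u).
    exact: measurable_profile hu hrad.
  apply: (measurableT_comp (measurable_conformal_weight n alpha mp)).
  exact: measurable_enorm.
have LW : Lambda = (\int[@lebesgue_tuple R n]_x (W x)%:E)%E.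
  by apply: eq_integral => x _; rewrite WE.
have [Loo|] := eqVneq Lambda +oo%E.
  split; first by rewrite Loo leey.
  rewrite Loo; split => // Q1; exfalso.
  (* for [Q = 1] the mass of [w] is the total variation of the curvature *)
  suff : Lambda = (\int[@lebesgue_tuple R n]_x
    (enorm x `^ (n%:R * alpha) * `|Q x| * expR (n%:R * u x))%:E)%E.
    by move=> E; move: hint; rewrite -E Loo ltxx.
  rewrite LW; apply: (@ae_eq_integral _ _ _ (lebesgue_tuple n) setT _ _ measurableT).
  - exact/measurable_EFinP.
  - have -> : (fun x : n.-tuple R =>
        (enorm x `^ (n%:R * alpha) * `|Q x| * expR (n%:R * u x))%:E) =
      (fun x => (W x * `|Q x|)%:E).
      by apply/funext => x; rewrite WE mulrAC.
    apply/measurable_EFinP; apply: measurable_funM => //.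
    by apply: (measurableT_comp _ hQ.1) => //.
  - by apply: filterS Q1 => x Qx _; rewrite WE Qx normr1 mulr1.
rewrite -ltey -ge0_fin_numE// => Lf.
have WL : (\int[@lebesgue_tuple R n]_x (W x)%:E = (fine Lambda)%:E)%E.
  by rewrite fineK.
have ge := mass_ge i01 hu hrad hQ1 WL.
have eq := mass_eq i01 hu hrad hQ1 WL.
rewrite -(fineK Lf) lee_fin; split; first exact: ge.
by split=> [[E]|Q1]; [apply/eq|congr EFin; apply/eq].
Qed.
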